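(* Let $K \subset \mathbb{R}^n$ be a convex body with $d_{BM}(K,\mathbb{B}_2^n) \geq n - \varepsilon$ for some $\varepsilon \in (0,\frac12)$. Then $$d_{BM}(K,\mathcal{S}^n) < 1 + 2\varepsilon + \frac{2\varepsilon^2}{1-2\varepsilon} = 1 + 2\varepsilon + \sum_{k=2}^\infty 2^{k-1}\varepsilon^k.$$ The resulting linear order of the estimate in $\varepsilon \leq \gamma$ for any $\gamma < \frac12$ is optimal.
   Context: A convex body in $\mathbb{R}^n$ is a compact convex set with non-empty interior. $\mathbb{B}_2^n$ is the Euclidean unit ball in $\mathbb{R}^n$. $\mathcal{S}^n$ denotes any $n$-dimensional simplex (convex hull of $n+1$ affinely independent points in $\mathbb{R}^n$). The Banach--Mazur distance between convex bodies $K, L \subset \mathbb{R}^n$ is $d_{BM}(K,L) = \inf\{\rho \geq 0 : u + K \subset AL \subset v + \rho K \text{ for some invertible } A \in \mathbb{R}^{n\times n} \text{ and } u,v \in \mathbb{R}^n\}$; it is invariant under invertible affine maps, so $d_{BM}(K,\mathcal{S}^n)$ does not depend on the choice of simplex. *)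

(* Defs.v *)
From HB Require Import structures.
From mathcomp Require Import all_boot all_order all_algebra.
From mathcomp Require Import all_classical all_reals all_analysis.

Set Implicit Arguments.
Unset Strict Implicit.
Unset Printing Implicit Defensive.

Import Order.TTheory GRing.Theory Num.Theory.
Import numFieldNormedType.Exports.

Local Open Scope classical_set_scope.
Local Open Scope ring_scope.

(* The library topology on ['cV[R]_n] is that of the sup norm, which is the
   usual topology of R^n. *)
Definition convex_body (R : realType) (n : nat) (K : set 'cV[R]_n) : Prop :=
  [/\ compact K, convex_set K & K° !=set0].

(* Spelled out, because the library norm on matrices is the sup norm. *)
Definition euclidean_ball (R : realType) (n : nat) : set 'cV[R]_n :=
  [set x | Num.sqrt (\sum_(i < n) x i 0 ^+ 2) <= 1].
Arguments euclidean_ball : clear implicits.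

Definition convex_hull (R : realType) (n : nat) (A : set 'cV[R]_n) :
    set 'cV[R]_n :=
  smallest (@convex_set R 'cV[R]_n) A.

Definition affinely_independent (R : realType) (n m : nat)
    (p : 'I_m -> 'cV[R]_n) : Prop :=
  forall l : 'I_m -> R,
    \sum_i l i = 0 -> \sum_i l i *: p i = 0 -> forall i, l i = 0.

Definition is_simplex (R : realType) (n : nat) (S : set 'cV[R]_n) : Prop :=
  exists p : 'I_n.+1 -> 'cV[R]_n,
    affinely_independent p /\ S = convex_hull (range p).

(* [inf] of the empty set or of a set unbounded below is 0, but neither case
   occurs when K and L are convex bodies. *)
Definition banach_mazur (R : realType) (n : nat) (K L : set 'cV[R]_n) : R :=
  inf [set rho : R | 0 <= rho /\
    exists (A : 'M[R]_n) (u v : 'cV[R]_n),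
      [/\ A \in unitmx,
          [set u + x | x in K] `<=` [set A *m x | x in L] &
          [set A *m x | x in L] `<=` [set v + rho *: x | x in K]]].

(* Main.v *)
Require Import Defs.
From HB Require Import structures.
From mathcomp Require Import all_boot all_order all_algebra.
From mathcomp Require Import all_classical all_reals all_analysis.
From mathcomp Require Import ring lra.

Set Implicit Arguments.
Unset Strict Implicit.
Unset Printing Implicit Defensive.

Import Order.TTheory GRing.Theory Num.Theory.
Import numFieldNormedType.Exports.

Local Open Scope classical_set_scope.
Local Open Scope ring_scope.

(** The stability estimate.  Apply an affine map so that the ellipsoid of
    minimal volume around [K] is the ball of radius [sqrt n] centred at the
    origin ([loewner]).  Then there is a probability measure on [K] with mean 0
    and identity covariance matrix; write [E] for its expectation.  Only the
    values of [E] on quadratic polynomials matter, so the measure is replaced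
    by a matrix that is positive on the quadratic polynomials nonnegative on
    [K], chosen with maximal determinant.  If the distance of [K] to the ball
    is at least [n - eps], then [K] contains no ball of radius larger than
    [sqrt n / (n - eps)].  By duality ([steep_partition]) and elimination of
    linear dependencies ([small_partition]), the constant 1 is a sum of at most
    [n + 1] affine functions [p_a >= 0] on [K] whose gradients [g_a] satisfy
    [(sum |g_a|)^2 >= n - 2 eps].

    Let [M_a] be the maximum of [p_a] on [K], let [y_a = E p_a], and let
    [D = sum (1 - M_a)].  Since [E p_a^2 = y_a^2 + |g_a|^2], positivity of
    [E (p_a (M_a - p_a))] and the Cauchy-Schwarz inequality yield
    [sum M_a >= 1 + n - 2 eps].  Hence there are exactly [n + 1] functions, so
    they cut out a simplex around [K], and [D <= 2 eps].  This is not yet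
    enough, because the quantities [E (p_a (M_a - p_a))] cannot all vanish: a
    point of [K] where [p_a] takes its maximal value [M_a < 1] has to give the
    mass [1 - M_a] to the other functions.  Taking this into account
    ([truncated_simplex_concavity], [max_ratio_bound]) improves the bound to
    [D <= eps / (1 - eps)] ([loewner_partition]).  Finally the points where the
    [p_a] are maximal span enough of [K] to contain a homothetic copy, with
    ratio [1 - D], of the simplex around [K] ([bm_ratio_sandwich]).  So the
    distance of [K] to the simplex is at most
    [1 / (1 - D) <= (1 - eps) / (1 - 2 eps)], which is [eps] less than the
    asserted bound.

    Optimality.  Cut one vertex off a simplex, at the barycentric coordinate
    [1 - eps].  The maxima of the barycentric coordinates then add up to
    [n + 1 - eps], and the distance to the ball is at least this sum minus 1
    ([bm_ball_lower_bound]).  The distance to the simplex is at least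
    [1 + eps / 20]: in a tight sandwich between homothetic simplices each of
    the [n] uncut vertices occupies a vertex of the inner simplex, which leaves
    a single one for all the new vertices near the cut
    ([truncated_simplex_far]). *)

(** * Euclidean geometry of column vectors *)

Definition dot (R : realType) (m : nat) (u v : 'cV[R]_m) : R :=
  \sum_i u i 0 * v i 0.

(** The norm that ['cV[R]_m] carries as a normed module is the sup norm. *)
Definition enorm (R : realType) (m : nat) (u : 'cV[R]_m) : R :=
  Num.sqrt (dot u u).

Section Dot.
Context {R : realType} {m : nat}.
Implicit Types (u v w : 'cV[R]_m) (a : R).

Lemma dotE u v : dot u v = (u^T *m v) 0 0.
Proof. by rewrite mxE; apply: eq_bigr => i _; rewrite mxE. Qed.

Lemma dotC u v : dot u v = dot v u.
Proof. by apply: eq_bigr => i _; rewrite mulrC. Qed.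

Lemma dotDr u v w : dot u (v + w) = dot u v + dot u w.
Proof. by rewrite !dotE mulmxDr mxE. Qed.

Lemma dotZr a u v : dot u (a *: v) = a * dot u v.
Proof. by rewrite !dotE -scalemxAr mxE. Qed.

Lemma dotNr u v : dot u (- v) = - dot u v.
Proof. by rewrite -scaleN1r dotZr mulN1r. Qed.

Lemma dotBr u v w : dot u (v - w) = dot u v - dot u w.
Proof. by rewrite dotDr dotNr. Qed.

Lemma dot0r u : dot u 0 = 0.
Proof. by rewrite !dotE mulmx0 mxE. Qed.

Lemma dotDl u v w : dot (u + v) w = dot u w + dot v w.
Proof. by rewrite dotC dotDr !(dotC w). Qed.

Lemma dotZl a u v : dot (a *: u) v = a * dot u v.
Proof. by rewrite dotC dotZr dotC. Qed.

Lemma dotNl u v : dot (- u) v = - dot u v.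
Proof. by rewrite dotC dotNr dotC. Qed.

Lemma dotBl u v w : dot (u - v) w = dot u w - dot v w.
Proof. by rewrite dotDl dotNl. Qed.

Lemma dot0l u : dot 0 u = 0.
Proof. by rewrite dotC dot0r. Qed.

Lemma dot_suml (I : Type) (r : seq I) (P : pred I) (F : I -> 'cV[R]_m) u :
  dot (\sum_(i <- r | P i) F i) u = \sum_(i <- r | P i) dot (F i) u.
Proof.
elim: r => [|i r IH]; first by rewrite !big_nil dot0l.
by rewrite !big_cons; case: (P i); rewrite ?dotDl IH.
Qed.

Lemma dot_ge0 u : 0 <= dot u u.
Proof. by apply: sumr_ge0 => i _; rewrite -expr2 sqr_ge0. Qed.

Lemma dot_eq0 u : dot u u = 0 -> u = 0.
Proof.
move/eqP; rewrite psumr_eq0 => [|i _]; last by rewrite -expr2 sqr_ge0.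
move=> /allP u0; apply/matrixP => i j; rewrite ord1 mxE.
by apply/eqP; have := u0 i (mem_index_enum _); rewrite -expr2 sqrf_eq0.
Qed.

Lemma dot_sqrDZ u v a :
  dot (u + a *: v) (u + a *: v) = dot u u + 2 * a * dot u v + a ^+ 2 * dot v v.
Proof. by rewrite dotDl !dotDr !dotZl !dotZr (dotC v u); ring. Qed.

Lemma enorm_ge0 u : 0 <= enorm u. Proof. exact: sqrtr_ge0. Qed.

Lemma enorm_sqr u : enorm u ^+ 2 = dot u u.
Proof. by rewrite sqr_sqrtr // dot_ge0. Qed.

Lemma enormZ a u : 0 <= a -> enorm (a *: u) = a * enorm u.
Proof.
move=> a0; rewrite /enorm dotZl dotZr mulrA -expr2 sqrtrM ?sqr_ge0 //.
by rewrite sqrtr_sqr ger0_norm.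
Qed.

Lemma dot_cauchy u v : dot u v <= enorm u * enorm v.
Proof.
have [v0|v0] := eqVneq (dot v v) 0.
  by rewrite (dot_eq0 v0) dot0r mulr_ge0 ?enorm_ge0.
have vv : 0 < dot v v by rewrite lt_neqAle eq_sym v0 dot_ge0.
have := dot_ge0 (dot v v *: u - dot u v *: v).
rewrite dotBl !dotBr !dotZl !dotZr (dotC v u) => H.
have {}H : dot u v ^+ 2 <= dot u u * dot v v.
  rewrite -subr_ge0 -(pmulr_rge0 _ vv); apply: le_trans H _; rewrite le_eqVlt.
  by apply/orP; left; apply/eqP; ring.
rewrite /enorm -sqrtrM ?dot_ge0 //; apply: le_trans (ler_norm _) _.
by rewrite -sqrtr_sqr; exact: ler_wsqrtr.
Qed.

Lemma enorm_coord u i : `|u i 0| <= enorm u.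
Proof.
rewrite -sqrtr_sqr ler_wsqrtr // /dot (bigD1 i) //= -expr2 lerDl sumr_ge0 //.
by move=> j _; rewrite -expr2 sqr_ge0.
Qed.

End Dot.

(** * Compactness and continuity in spaces of matrices *)

Section Topology.
Context {R : realType}.

Lemma closed_ge0 (T : topologicalType) (f : T -> R) :
  continuous f -> closed [set x | 0 <= f x].
Proof.
by move=> cf; apply: (@preimage_closed _ _ f [set y | 0 <= y]).
Qed.

Lemma continuous_sum (T : topologicalType) (I : Type) (r : seq I) (P : pred I)
    (F : I -> T -> R) :
  (forall i, continuous (F i)) -> continuous (fun x => \sum_(i <- r | P i) F i x).
Proof.
move=> cF x; elim: r => [|i r IH].
  by under eq_fun do rewrite big_nil; exact: cst_continuous.
under eq_fun do rewrite big_cons; case: (P i) => //.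
by apply: continuousD => //; exact: cF.
Qed.

Lemma continuous_prod (T : topologicalType) (I : Type) (r : seq I) (P : pred I)
    (F : I -> T -> R) :
  (forall i, continuous (F i)) ->
  continuous (fun x => \prod_(i <- r | P i) F i x).
Proof.
move=> cF x; elim: r => [|i r IH].
  by under eq_fun do rewrite big_nil; exact: cst_continuous.
under eq_fun do rewrite big_cons; case: (P i) => //.
by apply: continuousM => //; exact: cF.
Qed.

Lemma continuous_mx (T : topologicalType) (m n : nat) (f : T -> 'M[R]_(m, n)) :
  (forall i j, continuous (fun x => f x i j)) -> continuous f.
Proof.
move=> cf x; apply/cvgrPdist_lt => e e0.
near=> y; rewrite /Num.norm /= mx_normrE; apply/bigmax_ltP; split => // -[i j] _ /=.
rewrite !mxE; move: i j; near: y.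
apply: filter_forall => i; apply: filter_forall => j.
by have /cvgrPdist_lt /(_ e e0) := cf i j x.
Unshelve. all: by end_near. Qed.

Lemma continuous_scale (T : topologicalType) (a : R) (f : T -> R) :
  continuous f -> continuous (fun x => a * f x).
Proof. by move=> cf x; apply: cvgM; [exact: cvg_cst|exact: cf]. Qed.

Lemma continuous_shift (T : topologicalType) (a : R) (f : T -> R) :
  continuous f -> continuous (fun x => a + f x).
Proof. by move=> cf x; apply: cvgD; [exact: cvg_cst|exact: cf]. Qed.

Lemma continuous_det (n : nat) : continuous (fun A : 'M[R]_n => \det A).
Proof.
rewrite /determinant; apply: continuous_sum => s; apply: continuous_scale.
by apply: continuous_prod => i; exact: coord_continuous.
Qed.

Lemma continuous_dotr (m : nat) (u : 'cV[R]_m) : continuous (dot u).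
Proof.
apply: continuous_sum => i; apply: continuous_scale.
exact: coord_continuous.
Qed.

Lemma mx_heine_borel (m n : nat) (A : set 'M[R]_(m, n)) (b : R) :
  closed A -> (forall M, A M -> forall i j, `|M i j| <= b) -> compact A.
Proof.
move=> clA bA.
have cv : continuous (@vec_mx R m n).
  by apply: continuous_mx => i j x; under eq_fun do rewrite mxE;
     exact: coord_continuous.
have -> : A = vec_mx @` (vec_mx @^-1` A).
  apply/seteqP; split => [M AM|_ [v Av <-] //].
  by exists (mxvec M); rewrite /= mxvecK.
apply: continuous_compact; first exact: continuous_subspaceT.
apply: bounded_closed_compact.
  exists (`|b|); split; first exact: num_real.
  move=> x bx v /= Av; rewrite /Num.norm /= mx_normrE.
  apply/bigmax_leP; split; first by rewrite (le_trans _ (ltW bx)).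
  move=> [i j] _ /=; rewrite ord1; case/mxvec_indexP: j => k l.
  have := bA _ Av k l; rewrite mxE => /le_trans; apply.
  by rewrite (le_trans (ler_norm _)) // ltW.
by apply: preimage_closed => //; apply: cv.
Qed.

Lemma compact_mx_bounded (m n : nat) (A : set 'M[R]_(m, n)) :
  compact A -> exists2 b : R, 0 < b & forall M, A M -> forall i j, `|M i j| <= b.
Proof.
move=> /compact_bounded [b [_ bA]]; exists (`|b| + 1).
  by rewrite ltr_wpDl.
move=> M /(bA (`|b| + 1)) MA i j; have {}MA := MA _.
have /MA : b < `|b| + 1 by rewrite (le_lt_trans (ler_norm b)) // ltrDl.
apply: le_trans; rewrite [leRHS]/Num.norm /= mx_normrE.
by apply/bigmax_geP; right; exists (i, j).
Qed.

Lemma compact_mx_closed (m n : nat) (A : set 'M[R]_(m, n)) :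
  compact A -> closed A.
Proof. by apply: compact_closed; exact: norm_hausdorff. Qed.

Lemma compact_argmax (T : topologicalType) (f : T -> R) (A : set T) :
  A !=set0 -> compact A -> continuous f ->
  exists2 c, A c & forall t, A t -> f t <= f c.
Proof.
move=> A0 cA cf; have [c] := compact_EVT_max A0 cA (continuous_subspaceT cf).
by rewrite inE => Ac H; exists c => // t At; apply: H; rewrite inE.
Qed.

End Topology.

(** * Separation of a point from a closed convex set *)

Definition convexly_closed (R : realType) (m : nat) (C : set 'cV[R]_m) : Prop :=
  forall x y (t : R), 0 <= t <= 1 -> C x -> C y -> C (t *: x + (1 - t) *: y).

Section Separation.
Context {R : realType} {m : nat}.
Implicit Types (C : set 'cV[R]_m).

Lemma convex_setP C : @convex_set R 'cV[R]_m C <-> convexly_closed C.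
Proof.
split=> [cC x y t /andP[t0 t1] Cx Cy|cC x y l].
  pose l : {i01 R} := Itv01 t0 t1.
  by have := cC x y l; rewrite !inE => /(_ Cx Cy).
rewrite !inE => Cx Cy; apply: (cC x y l%:num) => //.
by rewrite ge0 le1.
Qed.

(** The separating hyperplane passes through the point of [C] nearest to [z]. *)
Lemma separation C (z : 'cV[R]_m) :
  closed C -> C !=set0 -> convexly_closed C -> ~ C z ->
  exists (v : 'cV[R]_m) (c : R), dot v z < c /\ forall y, C y -> c <= dot v y.
Proof.
move=> clC [y0 Cy0] cC nCz.
pose f y := dot (y - z) (y - z).
have cf : continuous f.
  have cfi i : continuous (fun y : 'cV[R]_m => (y - z) i 0).
    have -> : (fun y : 'cV[R]_m => (y - z) i 0) = (fun y => y i 0 - z i 0).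
      by apply/funext => y; rewrite !mxE.
    by move=> y; apply: continuousB; [exact: coord_continuous|exact: cst_continuous].
  by apply: continuous_sum => i y; exact: (cvgM (cfi i y) (cfi i y)).
pose A := C `&` [set y | 0 <= f y0 - f y].
have clA : closed A.
  apply: closedI => //; apply: closed_ge0 => y.
  exact: (cvgB (cvg_cst _) (cf y)).
have bA y : A y -> forall i j, `|y i j| <= enorm (y0 - z) + enorm z.
  move=> [_ /= fy] i j; rewrite ord1 -[y i 0](subrK (z i 0)).
  apply: le_trans (ler_normD _ _) _; apply: lerD; last exact: enorm_coord.
  have := enorm_coord (y - z) i; rewrite !mxE => /le_trans; apply.
  by rewrite ler_wsqrtr // -subr_ge0.
have A0 : A !=set0 by exists y0; split => //=; rewrite subrr.
have [|c [Cc _] cmax] := @compact_argmax R _ (fun y => - f y) A A0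
  (mx_heine_borel clA bA).
  by move=> y; exact: (cvgN (cf y)).
have {}cmax y : C y -> f c <= f y.
  move=> Cy; have [fy|fy] := lerP (f y) (f y0).
    by rewrite -lerN2 cmax //; split => //=; rewrite subr_ge0.
  apply: le_trans (ltW fy); rewrite -lerN2 cmax //; split => //=.
  by rewrite subrr.
pose v := c - z; exists v, (dot v c); split.
  rewrite -subr_gt0 -dotBr lt_neqAle dot_ge0 andbT eq_sym; apply/negP => /eqP.
  by move=> /dot_eq0 /eqP; rewrite subr_eq0 => /eqP cz; apply: nCz; rewrite -cz.
move=> y Cy; rewrite -subr_ge0 -dotBr; set d := y - c.
rewrite leNgt; apply/negP => vd.
have dd : 0 < dot d d.
  rewrite lt_neqAle dot_ge0 andbT eq_sym; apply/negP => /eqP /dot_eq0 d0.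
  by move: vd; rewrite d0 dot0r ltxx.
(* moving from c towards y by the fraction t would bring it closer to z *)
pose t := Num.min 1 (- dot v d / dot d d).
have t0 : 0 < t by rewrite lt_min ltr01 divr_gt0 // oppr_gt0.
have t1 : t <= 1 by rewrite ge_min lexx.
have td : t * dot d d <= - dot v d.
  by rewrite -ler_pdivlMr // ge_min lexx orbT.
have := cmax _ (cC y c t _ Cy Cc); rewrite (ltW t0) t1 => /(_ isT).
have -> : f (t *: y + (1 - t) *: c) = dot v v + 2 * t * dot v d + t ^+ 2 * dot d d.
  rewrite /f; have -> : t *: y + (1 - t) *: c - z = v + t *: d.
    by apply/matrixP => i j; rewrite !mxE; ring.
  exact: dot_sqrDZ.
rewrite /f -/v -addrA lerDl => H.
suff : 2 * t * dot v d + t ^+ 2 * dot d d < 0 by rewrite ltNge H.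
have -> : 2 * t * dot v d + t ^+ 2 * dot d d = t * (2 * dot v d + t * dot d d).
  by ring.
by rewrite pmulr_rlt0 //; lra.
Qed.

Lemma closure_mxP C (x : 'cV[R]_m) :
  closure C x <->
  forall e, 0 < e -> exists2 y, C y & forall i, `|x i 0 - y i 0| < e.
Proof.
split=> [Cx e e0|H B /nbhs_ballP[e e0 eB]].
  have [y [Cy [_ xy]]] := Cx _ (nbhsx_ballx x e e0).
  by exists y => // i; exact: xy.
have [y Cy xy] := H e e0; exists y; split => //; apply: eB; split => // i j.
by rewrite ord1; exact: xy.
Qed.

Lemma convexly_closed_closure C : convexly_closed C -> convexly_closed (closure C).
Proof.
move=> cC x y t /andP[t0 t1] /closure_mxP Cx /closure_mxP Cy.
apply/closure_mxP => e e0; have e2 : 0 < e / 2 by rewrite divr_gt0.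
have [x' Cx' xx'] := Cx _ e2; have [y' Cy' yy'] := Cy _ e2.
exists (t *: x' + (1 - t) *: y'); first by apply: cC => //; rewrite t0 t1.
move=> i; have -> : (t *: x + (1 - t) *: y) i 0 - (t *: x' + (1 - t) *: y') i 0
    = t * (x i 0 - x' i 0) + (1 - t) * (y i 0 - y' i 0) by rewrite !mxE; ring.
apply: le_lt_trans (ler_normD _ _) _; rewrite !normrM (ger0_norm t0).
rewrite (ger0_norm (_ : 0 <= 1 - t)) ?subr_ge0 //.
have := ler_wpM2l t0 (ltW (xx' i)).
have /ler_wpM2l /(_ _ _ (ltW (yy' i))) : 0 <= 1 - t by rewrite subr_ge0.
by lra.
Qed.

End Separation.

(** * Positive definite matrices and rank-one updates *)

Lemma interior_box (R : realType) (m n : nat) (K : set 'M[R]_(m, n)) x0 :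
  K° x0 ->
  exists2 s : R, 0 < s &
    forall y : 'M[R]_(m, n), (forall i j, `|y i j - x0 i j| <= s) -> K y.
Proof.
move=> /nbhs_ballP [e /= e0 eK]; exists (e / 2); first by rewrite divr_gt0.
move=> y xy; apply: eK; split=> // i j.
rewrite /ball /= distrC (le_lt_trans (xy i j)) //.
by rewrite ltr_pdivrMr // ltr_pMr // ltr1n.
Qed.

Section SymmetricMatrices.
Context {R : realType}.

Definition qform (n : nat) (G : 'M[R]_n) (v : 'cV[R]_n) : R :=
  (v^T *m G *m v) 0 0.

Definition positive_definite (n : nat) (G : 'M[R]_n) : Prop :=
  G^T = G /\ forall v, v != 0 -> 0 < qform G v.

(** One step of the Cholesky factorization, which splits off the Schur
    complement of the upper left entry.  It is kept separate from the induction
    because a moment matrix, whose corner entry is 1, acquires in this way a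
    factor that acts on [hat x] as an affine map of [x]. *)
Lemma cholesky_border (n : nat) (G : 'M[R]_(1 + n)) :
  (forall S : 'M[R]_n, positive_definite S -> exists L : 'M[R]_n, S = L *m L^T) ->
  positive_definite G ->
  exists (c : 'cV[R]_n) (L : 'M[R]_n),
    let F := block_mx (Num.sqrt (G 0 0))%:M 0 c L in G = F *m F^T.
Proof.
move=> chol [Gs Gp]; pose a := G 0 0; pose b := dlsubmx G; pose D := drsubmx G.
have l0 : lshift n (0 : 'I_1) = 0 by exact/val_inj.
have GE : G = block_mx a%:M b^T b D.
  rewrite -[LHS]submxK; congr block_mx.
    by rewrite [LHS]mx11_scalar !mxE l0.
  by rewrite /b trmx_dlsub Gs.
have Ds : D^T = D by rewrite /D trmx_drsub Gs.
have a0 : 0 < a.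
  have := Gp (col_mx 1%:M 0); rewrite /qform GE tr_col_mx mul_row_block.
  rewrite mul_row_col trmx0 !mul0mx !mulmx0 !addr0 trmx1 mul1mx mulmx1 mxE eqxx.
  apply; apply/eqP => /(congr1 usubmx); rewrite col_mxKu => /matrixP /(_ 0 0).
  by rewrite !mxE eqxx => /eqP; rewrite oner_eq0.
pose r := Num.sqrt a; have r0 : r != 0 by rewrite gt_eqF // sqrtr_gt0.
have rr : r * r = a by rewrite -expr2 sqr_sqrtr // ltW.
pose S := D - a^-1 *: (b *m b^T).
have [L SL] : exists L : 'M[R]_n, S = L *m L^T.
  apply: chol; split.
    by rewrite /S linearB linearZ /= trmx_mul trmxK Ds.
  move=> v v0; pose c0 := (b^T *m v) 0 0.
  have bv : b^T *m v = c0%:M by rewrite [LHS]mx11_scalar.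
  have vb : v^T *m b = c0%:M by rewrite -[LHS]trmxK trmx_mul trmxK bv tr_scalar_mx.
  have := Gp (col_mx (- (c0 / a))%:M v); rewrite /qform GE tr_col_mx mul_row_block.
  rewrite tr_scalar_mx -scalar_mxM vb -raddfD /= mulNr divfK ?gt_eqF // addNr.
  rewrite mul_row_col raddf0 mul0mx add0r mulmxDl !mul_scalar_mx -scalemxAl bv.
  rewrite /S mulmxBr mulmxBl -scalemxAr -scalemxAl mulmxA -(mulmxA (v^T *m b)).
  rewrite bv vb -scalar_mxM => H.
  have -> : (v^T *m D *m v - a^-1 *: (c0 * c0)%:M) 0 0 =
            (- (c0 / a) *: c0%:M + v^T *m D *m v) 0 0.
    by rewrite ![in LHS]mxE ![in RHS]mxE eqxx !mulr1n; field; rewrite gt_eqF.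
  apply: H; apply/eqP => /(congr1 dsubmx); rewrite col_mxKd linear0.
  exact/eqP.
exists (r^-1 *: b), L; rewrite /= -/a -/r tr_block_mx mulmx_block.
rewrite !tr_scalar_mx trmx0 !mulmx0 !mul0mx !addr0 -scalar_mxM rr [LHS]GE.
rewrite linearZ /= mul_scalar_mx mul_mx_scalar !scalerA divff // !scale1r.
rewrite -scalemxAl -scalemxAr scalerA -SL /S -invfM rr addrCA subrr addr0.
by [].
Qed.

Lemma cholesky (n : nat) (G : 'M[R]_n) :
  positive_definite G -> exists L : 'M[R]_n, G = L *m L^T.
Proof.
elim: n G => [|n IH] G Gp; first by exists 0; apply/matrixP => -[].
by have [c [L GE]] := @cholesky_border n G IH Gp; eexists; exact: GE.
Qed.

Lemma qform_line (n : nat) (G : 'M[R]_n) (v y : 'cV[R]_n) (t : R) :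
  qform G (v + t *: y) = qform G v + t * (v^T *m G *m y) 0 0
    + t * (y^T *m G *m v) 0 0 + t ^+ 2 * qform G y.
Proof.
rewrite /qform; have -> : (v + t *: y)^T = v^T + t *: y^T.
  by rewrite linearD linearZ.
rewrite ![in LHS]mulmxDl mulmxDr -!scalemxAl mulmxDr -!scalemxAr.
move: (_ *m G *m v) (_ *m G *m y) (_ *m G *m v) (_ *m G *m y) => A B C D.
by rewrite !mxE; ring.
Qed.

(** A semidefinite form vanishes only on its kernel. *)
Lemma psd_positive_definite (n : nat) (G : 'M[R]_n) :
  G^T = G -> (forall v, 0 <= qform G v) -> \det G != 0 -> positive_definite G.
Proof.
move=> Gs Gp dG; split=> // v v0; rewrite lt_neqAle Gp andbT eq_sym.
apply/negP => /eqP qv; pose y := G *m v.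
have y0 : dot y y != 0.
  apply/eqP => /dot_eq0 Gv; move/eqP: v0; apply.
  by rewrite -[v](@mulKmx _ _ _ G) ?unitmxE ?unitfE // -/y Gv mulmx0.
have s0 : 0 < dot y y by rewrite lt_neqAle eq_sym y0 dot_ge0.
have q0 := Gp y; set q := qform G y in q0.
pose t := - (dot y y / (q + 1)).
have := Gp (v + t *: y).
have -> : qform G (v + t *: y) = t * (2 * dot y y + t * q).
  have dvy : (v^T *m G *m y) 0 0 = dot y y.
    by rewrite dotE -[v^T *m G]trmxK trmx_mul trmxK Gs.
  have dyv : (y^T *m G *m v) 0 0 = dot y y by rewrite -mulmxA dotE.
  by rewrite qform_line qv dvy dyv -/q; ring.
have t0 : t < 0 by rewrite oppr_lt0 divr_gt0 // ltr_wpDl.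
rewrite nmulr_rge0 // leNgt => /negP; apply.
have : dot y y / (q + 1) * q <= dot y y.
  rewrite mulrAC ler_pdivrMr ?ltr_wpDl //; nra.
by rewrite /t; lra.
Qed.

(** Evaluate the determinant of the bordered matrix with blocks 1, - v, u, 1 by
    eliminating either of its two diagonal blocks. *)
Lemma det_add_rank1 (n : nat) (u : 'cV[R]_n) (v : 'rV[R]_n) :
  \det (1%:M + u *m v) = 1 + (v *m u) 0 0.
Proof.
pose X := block_mx (1%:M : 'M[R]_1) (- v) u 1%:M.
have X1 : X = block_mx 1%:M 0 u 1%:M *m block_mx 1%:M (- v) 0 (1%:M + u *m v).
  rewrite mulmx_block !mul1mx !mul0mx !mulmx1 !addr0 mulmxN.
  by rewrite [_ + (1%:M + _)]addrC addrK.
have X2 : X = block_mx (1%:M + v *m u) (- v) 0 1%:M *m block_mx 1%:M 0 u 1%:M.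
  rewrite mulmx_block !mulmx1 !mulmx0 !mul1mx !add0r mulNmx addrK.
  by [].
have := X1; rewrite X2 => /(congr1 determinant).
rewrite !det_mulmx !det_ublock !det_lblock !det1 !mulr1 !mul1r => <-.
by rewrite det_mx11 !mxE eqxx.
Qed.

End SymmetricMatrices.

(** * Loewner position *)

(** Homogeneous coordinates: a vector [p] of length [1 + n] stands for the
    affine function [x |-> dot p (hat x)], with constant term [p 0 0] and
    gradient [dsubmx p]; a matrix [Q] of order [1 + n] stands for the quadratic
    polynomial [x |-> \tr (Q *m moment x)]. *)
Definition hat (R : realType) (n : nat) (x : 'cV[R]_n) : 'cV[R]_(1 + n) :=
  col_mx 1%:M x.

Definition moment (R : realType) (n : nat) (x : 'cV[R]_n) : 'M[R]_(1 + n) :=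
  hat x *m (hat x)^T.

(** The ellipsoid of minimal volume around [K] is the ball of radius [sqrt n]
    centred at 0.  By John's theorem this means that some probability measure
    on [K] has mean 0 and identity covariance; the quadratic polynomial [Q] then
    has expectation [\tr Q], and the first condition is the dual form of the
    existence of such a measure. *)
Definition loewner_position (R : realType) (n : nat) (K : set 'cV[R]_n) : Prop :=
  (forall Q : 'M[R]_(1 + n),
     (forall x, K x -> 0 <= \tr (Q *m moment x)) -> 0 <= \tr Q) /\
  (forall x, K x -> dot x x <= n%:R).

Section Loewner.
Context {R : realType} {n : nat}.
Implicit Types (K : set 'cV[R]_n) (Q G : 'M[R]_(1 + n)) (x : 'cV[R]_n).

Lemma hat00 x : hat x 0 0 = 1.
Proof.
by rewrite /hat mxE; case: splitP => [j _|//]; rewrite ord1 mxE eqxx.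
Qed.

Lemma moment00 x : moment x 0 0 = 1.
Proof. by rewrite /moment mxE big_ord1 [X in _ * X]mxE hat00 mulr1. Qed.

Lemma affine_hat (c x : 'cV[R]_n) (L : 'M[R]_n) :
  block_mx 1%:M 0 c L *m hat x = hat (L *m x + c).
Proof. by rewrite mul_block_col mul0mx addr0 !mulmx1 addrC. Qed.

Lemma trace_delta_mx (k l : 'I_(1 + n)) Q : \tr (delta_mx k l *m Q) = Q l k.
Proof.
rewrite /mxtrace (bigD1 k) //= big1 ?addr0 => [|p pk]; rewrite mxE.
  rewrite (bigD1 l) //= mxE !eqxx mul1r big1 ?addr0 // => p pl.
  by rewrite mxE (negPf pl) andbF mul0r.
by rewrite big1 // => q _; rewrite mxE (negPf pk) mul0r.
Qed.

(** The closed convex hull of the moment matrices of the points of [K],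
    described by its supporting half-spaces. *)
Definition moment_body K : set 'M[R]_(1 + n) :=
  [set G : 'M[R]_(1 + n) | G 0 0 = 1 /\
     forall Q, (forall x, K x -> 0 <= \tr (Q *m moment x)) -> 0 <= \tr (Q *m G)].

Lemma moment_body_moment K x : K x -> moment_body K (moment x).
Proof. by move=> Kx; split; [exact: moment00|move=> Q; exact]. Qed.

Lemma moment_body_convex K G G' t : 0 <= t <= 1 ->
  moment_body K G -> moment_body K G' ->
  moment_body K (t *: G + (1 - t) *: G').
Proof.
move=> /andP[t0 t1] [G1 GQ] [G'1 G'Q]; split=> [|Q KQ].
  by rewrite !mxE G1 G'1; ring.
rewrite mulmxDr -!scalemxAr mxtraceD !mxtraceZ addr_ge0 // mulr_ge0 ?GQ ?G'Q //.
by rewrite subr_ge0.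
Qed.

Lemma moment_body_sym K G : moment_body K G -> G^T = G.
Proof.
move=> [_ GQ]; apply/matrixP => i j; rewrite mxE.
have key k l : 0 <= G k l - G l k.
  have := GQ (delta_mx l k - delta_mx k l).
  rewrite mulmxBl raddfB /= !trace_delta_mx; apply=> x _.
  rewrite mulmxBl raddfB /= !trace_delta_mx.
  by rewrite /moment !mxE; under eq_bigr do rewrite mulrC; rewrite subr_ge0;
     apply: ler_sum => p _; rewrite !mxE.
by apply/eqP; rewrite -subr_eq0 eq_le -oppr_ge0 opprB !key.
Qed.

Lemma moment_body_psd K G v : moment_body K G -> 0 <= qform G v.
Proof.
have trE (A : 'M[R]_(1 + n)) : \tr (v *m v^T *m A) = qform A v.
  by rewrite -mulmxA mxtrace_mulC trace_mx11.
move=> [_ /(_ (v *m v^T))]; rewrite trE; apply=> x _.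
rewrite trE /qform /moment mulmxA -mulmxA mxE big_ord1 -!dotE (dotC v).
by rewrite -expr2 sqr_ge0.
Qed.

Lemma moment_body_compact K : compact K -> compact (moment_body K).
Proof.
move=> /compact_mx_bounded [b b0 Kb].
pose B := Num.max 1 b.
have hB x i : K x -> `|hat x i 0| <= B.
  move=> Kx; rewrite /hat mxE; case: splitP => j _; rewrite le_max.
    by rewrite mxE ord1 eqxx normr1 lexx.
  by rewrite Kb ?orbT.
have B0 : 0 <= B by rewrite le_max ler01.
have ctr Q : continuous (fun G : 'M[R]_(1 + n) => \tr (Q *m G)).
  apply: continuous_sum => i.
  have -> : (fun G : 'M[R]_(1 + n) => (Q *m G) i i) = (fun G => \sum_j Q i j * G j i).
    by apply/funext => G; rewrite mxE.
  by apply: continuous_sum => j; apply: continuous_scale; exact: coord_continuous.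
apply: (@mx_heine_borel _ _ _ _ (B ^+ 2)).
  have -> : moment_body K = (fun G : 'M[R]_(1 + n) => G 0 0) @^-1` [set 1] `&`
      \bigcap_(Q in [set Q | forall x, K x -> 0 <= \tr (Q *m moment x)])
        [set G : 'M[R]_(1 + n) | 0 <= \tr (Q *m G)].
    by apply/seteqP; split => G /= [G1 GQ].
  apply: closedI.
    by apply: preimage_closed; [move=> ? _; exact: coord_continuous|exact: closed_eq].
  by apply: closed_bigI => Q _; exact: closed_ge0.
move=> G [G1 GQ] i j.
have key s : `|s| = 1 -> 0 <= B ^+ 2 + s * G i j.
  move=> s1; have := GQ (B ^+ 2 *: delta_mx 0 0 + s *: delta_mx j i).
  have E A : \tr ((B ^+ 2 *: delta_mx 0 0 + s *: delta_mx j i) *m A)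
      = B ^+ 2 * A 0 0 + s * A i j.
    by rewrite mulmxDl mxtraceD -!scalemxAl !mxtraceZ !trace_delta_mx.
  rewrite E G1 mulr1; apply=> x Kx; rewrite E moment00 mulr1.
  suff : `|s * moment x i j| <= B ^+ 2 by rewrite ler_norml => /andP[]; lra.
  rewrite normrM s1 mul1r /moment mxE big_ord1 [X in _ * X]mxE normrM expr2.
  by rewrite ler_pM // hB.
have := key 1 (normr1 _); have := key (- 1); rewrite normrN1 => /(_ erefl).
by rewrite ler_norml => ? ?; apply/andP; split; lra.
Qed.

(** A box inside [K] supplies a moment matrix of positive determinant: average
    the moments of the points [x0 + s e_i] and [x0 - s e_i]. *)
Lemma moment_body_nondegenerate K : (0 < n)%N -> K° !=set0 ->
  exists2 G, moment_body K G & 0 < \det G.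
Proof.
move=> n0 [x0 /interior_box [s s0 sK]].
have nR : 0 < n%:R :> R by rewrite ltr0n.
pose sg := s / Num.sqrt n%:R.
have sg0 : 0 < sg by rewrite divr_gt0 // sqrtr_gt0.
pose F := block_mx (1%:M : 'M[R]_1) 0 x0 sg%:M.
exists (F *m F^T); last first.
  by rewrite det_mulmx det_tr -expr2 exprn_even_gt0 // det_lblock det1 mul1r
             det_scalar expf_neq0 // gt_eqF.
pose e i : 'cV[R]_(1 + n) := col_mx 0 (delta_mx i 0).
have FF : F *m F^T = moment x0 + sg ^+ 2 *: \sum_i e i *m (e i)^T.
  have -> : \sum_i e i *m (e i)^T = block_mx 0 0 0 1%:M.
    pose J : 'M[R]_(1 + n, n) := col_mx 0 1%:M.
    transitivity (\sum_i J *m delta_mx i i *m J^T).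
      apply: eq_bigr => i _.
      have -> : e i = J *m delta_mx i 0 by rewrite mul_col_mx mul0mx mul1mx.
      by rewrite trmx_mul trmx_delta mulmxA -(mulmxA J) mul_delta_mx.
    rewrite -mulmx_suml -mulmx_sumr -mx1_sum_delta mulmx1 tr_col_mx mul_col_row.
    by rewrite !trmx0 !mul0mx mulmx0 trmx1 mul1mx.
  rewrite /F tr_block_mx mulmx_block /moment /hat tr_col_mx mul_col_row.
  rewrite scale_block_mx add_block_mx !scaler0 !trmx0 !mulmx0 !mul0mx !addr0.
  by rewrite !trmx1 tr_scalar_mx !mul1mx !mulmx1 -[sg%:M *m _]scalar_mxM -expr2 scalemx1.
split=> [|Q KQ].
  rewrite FF mxE moment00 [X in _ + X]mxE summxE big1 ?mulr0 ?addr0 // => i _.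
  rewrite mxE big_ord1 /e mxE.
  by case: splitP => [j _|//]; rewrite mxE mul0r.
have Kpm i (t : R) : `|t| = s -> K (x0 + t *: delta_mx i 0).
  move=> ts; apply: sK => k l; rewrite ord1 !mxE addrAC subrr add0r normrM ts eqxx andbT.
  by case: eqP => _; rewrite ?normr1 ?normr0 ?mulr1 ?mulr0 // ltW.
have hatpm i (t : R) : hat (x0 + t *: delta_mx i 0) = hat x0 + t *: e i.
  by rewrite /hat /e scale_col_mx add_col_mx scaler0 addr0.
have key i : 0 <= \tr (Q *m moment x0) + s ^+ 2 * \tr (Q *m (e i *m (e i)^T)).
  have := KQ _ (Kpm i s (gtr0_norm s0)).
  have := KQ _ (Kpm i (- s) (etrans (normrN _) (gtr0_norm s0))).
  have E t : \tr (Q *m moment (x0 + t *: delta_mx i 0)) =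
     \tr (Q *m moment x0) + t * (\tr (Q *m (e i *m (hat x0)^T))
       + \tr (Q *m (hat x0 *m (e i)^T))) + t ^+ 2 * \tr (Q *m (e i *m (e i)^T)).
    rewrite /moment hatpm; have -> : (hat x0 + t *: e i)^T = (hat x0)^T + t *: (e i)^T.
      by rewrite linearD linearZ.
    rewrite mulmxDl !mulmxDr -?scalemxAl -?scalemxAr ?mulmxDr -?scalemxAr ?scalerA.
    by rewrite !mxtraceD !mxtraceZ; ring.
  by rewrite !E; lra.
rewrite FF mulmxDr mxtraceD -scalemxAr mxtraceZ mulmx_sumr raddf_sum /= mulr_sumr.
have sgE : sg ^+ 2 = s ^+ 2 / n%:R by rewrite expr_div_n sqr_sqrtr // ltW.
have -> : \tr (Q *m moment x0) = \sum_(i < n) \tr (Q *m moment x0) / n%:R.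
  by rewrite sumr_const card_ord -[RHS]mulr_natr divfK // gt_eqF.
rewrite -big_split /= sumr_ge0 // => i _.
have -> : \tr (Q *m moment x0) / n%:R + sg ^+ 2 * \tr (Q *m (e i *m (e i)^T)) =
  (\tr (Q *m moment x0) + s ^+ 2 * \tr (Q *m (e i *m (e i)^T))) / n%:R.
  by rewrite sgE; field; rewrite gt_eqF.
by rewrite divr_ge0 // ltW.
Qed.

Lemma det_segment_rank1 (x : 'cV[R]_n) (t : R) : 0 < t < 1 ->
  \det ((1 - t) *: 1%:M + t *: moment x) =
  (1 - t) ^+ n * (1 - t + t * dot (hat x) (hat x)).
Proof.
move=> /andP[t0 t1]; have u0 : 1 - t != 0 by rewrite subr_eq0 gt_eqF.
have -> : (1 - t) *: 1%:M + t *: moment x =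
    (1 - t) *: (1%:M + (t / (1 - t) *: hat x) *m (hat x)^T).
  by rewrite scalerDr -scalemxAl scalerA mulrC divfK.
rewrite detZ det_add_rank1 -scalemxAr mxE -dotE exprS.
by rewrite [1 - t]lock; field; rewrite -lock.
Qed.

Lemma bernoulli_le (k : nat) (t : R) : 0 <= t <= 1 ->
  1 - k%:R * t <= (1 - t) ^+ k.
Proof.
move=> /andP[t0 t1]; elim: k => [|k IH]; first by rewrite mul0r subr0 expr0.
rewrite exprS -natr1.
have : (1 - t) * (1 - k%:R * t) <= (1 - t) * (1 - t) ^+ k.
  by rewrite ler_wpM2l // subr_ge0.
apply: le_trans; have k0 : 0 <= k%:R :> R by rewrite ler0n.
have := mulr_ge0 k0 (mulr_ge0 t0 t0); nra.
Qed.

(** The first-order condition for a maximum at [t = 0]. *)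
Lemma rank1_derivative_bound (w : R) :
  (forall t, 0 < t < 1 -> (1 - t) ^+ n * (1 - t + t * w) <= 1) -> w <= n%:R + 1.
Proof.
move=> H; rewrite leNgt; apply/negP => wn.
have n0 : 0 <= n%:R :> R by rewrite ler0n.
(* to first order in t the product is 1 + t (w - n - 1) *)
pose t := Num.min (1 / 2) ((w - n%:R - 1) / (2 * (n%:R * (w - 1) + 1))).
have d0 : 0 < n%:R * (w - 1) + 1 by rewrite ltr_wpDl // mulr_ge0 //; lra.
have t0 : 0 < t by rewrite lt_min !divr_gt0 //; [lra|rewrite mulr_gt0].
have t1 : t <= 1 / 2 by rewrite ge_min lexx.
have t2 : t * (2 * (n%:R * (w - 1) + 1)) <= w - n%:R - 1.
  by rewrite -ler_pdivlMr ?mulr_gt0 // ge_min lexx orbT.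
have := H t; rewrite t0 /= => /(_ _); have -> : t < 1 by lra.
move=> /(_ isT); apply/negP; rewrite -ltNge.
have b : 1 - n%:R * t <= (1 - t) ^+ n by apply: bernoulli_le; lra.
have p0 : 0 <= 1 - t + t * w by nra.
have := ler_wpM2r p0 b; apply: lt_le_trans.
have -> : (1 - n%:R * t) * (1 - t + t * w) =
  1 + t * (w - n%:R - 1 - t * (n%:R * (w - 1))) by ring.
by rewrite ltrDl mulr_gt0 //; nra.
Qed.

(** The determinant is maximal on the moment body at some [G].  A Cholesky
    factor of [G] defines the affine map that transforms [G] into the identity.
    Moving from the identity towards the moment matrix of a point [w] must not
    increase the determinant, which says that [1 + |w|^2 <= n + 1]. *)
Theorem loewner K : (0 < n)%N -> compact K -> K° !=set0 ->
  exists (L : 'M[R]_n) (c : 'cV[R]_n),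
    L \in unitmx /\ loewner_position [set w | K (L *m w + c)].
Proof.
move=> n0 cK iK; have [G0 MG0 dG0] := moment_body_nondegenerate n0 iK.
have [G MG Gmax] := compact_argmax (ex_intro _ G0 MG0) (moment_body_compact cK)
  (@continuous_det R (1 + n)).
have dG : 0 < \det G := lt_le_trans dG0 (Gmax _ MG0).
have Gpd : positive_definite G.
  apply: psd_positive_definite; rewrite ?gt_eqF //; first exact: moment_body_sym MG.
  by move=> v; exact: moment_body_psd MG.
have [c [L /=]] := cholesky_border (@cholesky R n) Gpd.
have [G1 GQ] := MG; rewrite G1 sqrtr1; set F := block_mx _ _ _ _ => GE.
have dF : \det F != 0.
  by apply: contraTneq dG => dF0; rewrite GE det_mulmx dF0 mul0r ltxx.
have FU : F \in unitmx by rewrite unitmxE unitfE.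
have momF w : moment (L *m w + c) = F *m moment w *m F^T.
  by rewrite /moment -affine_hat trmx_mul !mulmxA.
exists L, c; split; first by move: dF; rewrite det_lblock det1 mul1r unitmxE unitfE.
split=> [Q KQ|w Kw].
  pose Q' := (invmx F)^T *m Q *m invmx F.
  have trE A : \tr (Q' *m (F *m A *m F^T)) = \tr (Q *m A).
    rewrite /Q' !mulmxA mulmxKV // mxtrace_mulC !mulmxA -trmx_mul mulVmx //.
    by rewrite trmx1 mul1mx.
  have F1 : F *m F^T = F *m 1%:M *m F^T by rewrite mulmx1.
  have := GQ Q'; rewrite GE F1 trE mulmx1; apply=> x Kx.
  have := KQ (invmx L *m (x - c)).
  have LU : L \in unitmx by move: dF; rewrite det_lblock det1 mul1r unitmxE unitfE.
  have xE : L *m (invmx L *m (x - c)) + c = x by rewrite mulKVmx // subrK.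
  by rewrite /= xE => /(_ Kx); rewrite -trE -momF xE.
have : dot (hat w) (hat w) <= n%:R + 1.
  apply: rank1_derivative_bound => t t01; rewrite -det_segment_rank1 //.
  have t01' : 0 <= 1 - t <= 1 by case/andP: t01 => ? ?; apply/andP; split; lra.
  have := Gmax _ (moment_body_convex t01' MG (@moment_body_moment K _ Kw)).
  rewrite subKr momF GE.
  have -> : (1 - t) *: (F *m F^T) + t *: (F *m moment w *m F^T) =
      F *m ((1 - t) *: 1%:M + t *: moment w) *m F^T.
    by rewrite mulmxDr mulmxDl -!scalemxAr -!scalemxAl mulmx1.
  rewrite !det_mulmx det_tr mulrAC ger_pMr //.
  by rewrite -expr2 exprn_even_gt0.
have -> : dot (hat w) (hat w) = 1 + dot w w.
  by rewrite !dotE /hat tr_col_mx mul_row_col trmx1 mulmx1 !mxE eqxx.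
by rewrite addrC lerD2r.
Qed.

End Loewner.

(** * Two inequalities for truncated simplices *)

Section TruncatedSimplex.
Context {R : realFieldType} {I : finType}.
Implicit Types (p M d y x : I -> R).

(** On the simplex [sum p = 1] truncated by [p_b <= 1 - d_b], the concave
    function [1 - sum p_b^2 / (1 - d_b)] lies above a linear one.  The extreme
    points put [1 - d_a] on one index and [d_a] on another one, and there the
    inequality reads [1 - d_a - d_b >= 1 - sum d].  At most one summand is
    negative; it is compared with the sum of the others. *)
Lemma truncated_simplex_concavity p d :
  (forall b, 0 <= p b) -> \sum_b p b = 1 -> (forall b, 0 <= d b) ->
  (forall b, p b <= 1 - d b) -> \sum_b d b < 1 ->
  0 <= \sum_b p b * (1 - d b - p b - (1 - \sum_b d b) * d b) / (1 - d b).
Proof.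
move=> p0 p1 d0 pM; set D := \sum_b d b => D1.
have dD b : d b <= D by rewrite /D (bigD1 b) //= lerDl sumr_ge0.
pose t b := 1 - d b - p b - (1 - D) * d b; rewrite -/t.
have M0 b : 0 < 1 - d b by have := dD b; lra.
have [/forallP tpos|] := boolP [forall b, 0 <= t b].
  apply: sumr_ge0 => b _; apply: divr_ge0; last exact: ltW.
  exact: mulr_ge0 (p0 b) (tpos b).
rewrite negb_forall => /existsP [a]; rewrite -ltNge => ta.
have pa1 : 1 - p a = \sum_(b | b != a) p b.
  by rewrite -p1 (bigD1 a) //= addrAC subrr add0r.
pose e := D - d a.
have e1 : 0 < 1 - e by have := d0 a; rewrite /e; lra.
have db b : b != a -> d b <= e.
  move=> ba; rewrite /e /D (bigD1 a) //= addrAC subrr add0r.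
  by rewrite (bigD1 b) //= lerDl sumr_ge0.
pose c := (p a - (2 - D) * e) / (1 - e).
have tc b : b != a -> c <= t b / (1 - d b).
  move=> ba; rewrite /c ler_pdivrMr // mulrAC ler_pdivlMr //.
  have pb : p b <= 1 - p a.
    by rewrite pa1 (bigD1 b) //= lerDl sumr_ge0.
  have tb : p a - (2 - D) * d b <= t b by rewrite /t; lra.
  have := ler_wpM2r (ltW e1) tb; apply: le_trans.
  rewrite -subr_ge0.
  have -> : (p a - (2 - D) * d b) * (1 - e) - (p a - (2 - D) * e) * (1 - d b)
     = (e - d b) * (2 - D - p a) by ring.
  by rewrite mulr_ge0 ?subr_ge0 ?db //; have := pM a; have := d0 a; lra.
rewrite (bigD1 a) //=.
have : (1 - p a) * c <= \sum_(b | b != a) p b * t b / (1 - d b).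
  rewrite pa1 mulr_suml; apply: ler_sum => b ba.
  by rewrite -mulrA ler_wpM2l // tc.
rewrite -/(t a) => H; apply: le_trans (_ : p a * t a / (1 - d a) + (1 - p a) * c <= _);
  last by rewrite lerD2l.
have -> : p a * t a / (1 - d a) + (1 - p a) * c =
    (2 - D) * (1 - d a - p a) * (p a - e) / ((1 - d a) * (1 - e)).
  by rewrite /c /t /e; field; rewrite -/e !gt_eqF.
rewrite divr_ge0 //; last by rewrite mulr_ge0 // ltW.
have pae : e <= p a.
  have := mulr_ge0 (ltW (_ : 0 < 1 - D)) (ltW (M0 a)).
  by move: ta; rewrite subr_gt0 /t /e => ? /(_ D1); lra.
by rewrite !mulr_ge0 ?subr_ge0 //; lra.
Qed.

(** Weights [y_b >= (1 - d_b) / N] of total mass 1 exceed these lower bounds by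
    [sum d / N] altogether; so the largest ratio [beta] of [y_b] to
    [1 - d_b] is close to [1 / N], unless it is attained where [d_b] is large. *)
Lemma max_ratio_bound y d : (0 < #|I|)%N ->
  (forall b, 0 <= d b) -> \sum_b d b < 1 -> \sum_b y b = 1 ->
  (forall b, 1 - d b <= #|I|%:R * y b) ->
  exists beta, [/\ 0 < beta, forall b, y b <= beta * (1 - d b) &
    let D := \sum_b d b in
    D / (1 + D) * beta <= \sum_b d b * y b / (1 - d b)].
Proof.
move=> /card_gt0P [b0 _] d0 D1 y1 yN.
set N := #|I|%:R in yN *; set D := \sum_b d b in D1 *.
have dD b : d b <= D by rewrite /D (bigD1 b) //= lerDl sumr_ge0.
have M0 b : 0 < 1 - d b by have := dD b; lra.
have N0 : 0 < N by rewrite ltr0n; apply/card_gt0P; exists b0.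
pose r b := y b / (1 - d b).
pose a := [arg max_(b > b0) r b]%O.
have ra b : r b <= r a by rewrite /a; case: arg_maxP => // i _; exact.
have rN b : 1 / N <= r b.
  by rewrite /r ler_pdivlMr // mulrAC ler_pdivrMr // mul1r mulrC.
have ra0 : 0 < r a by apply: lt_le_trans (rN a); rewrite divr_gt0.
have yr b : y b = r b * (1 - d b) by rewrite /r divfK // gt_eqF.
exists (r a); split=> // [b|/=]; first by rewrite yr ler_wpM2r // ltW.
have S b : d b * y b / (1 - d b) = d b * r b by rewrite /r mulrA.
under eq_bigr do rewrite S.
have rest : (D - d a) / N <= \sum_(b | b != a) d b * r b.
  rewrite {1}/D (bigD1 a) //= addrAC subrr add0r mulr_suml.
  apply: ler_sum => b _; rewrite ler_wpM2l // (le_trans _ (rN b)) //.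
  by rewrite mul1r.
have tot : r a * N * (1 - d a) <= 1 + D - d a.
  have : \sum_(b | b != a) (1 - d b) <= N * \sum_(b | b != a) y b.
    by rewrite mulr_sumr; apply: ler_sum.
  have -> : \sum_(b | b != a) y b = 1 - y a.
    by rewrite -y1 [in RHS](bigD1 a) //= addrAC subrr add0r.
  have -> : \sum_(b | b != a) (1 - d b) = N - D - (1 - d a).
    have -> : N - D = \sum_b (1 - d b).
      by rewrite sumrB sumr_const -[1 *+ _]/(#|I|%:R).
    by rewrite [in RHS](bigD1 a) //= addrAC subrr add0r.
  by rewrite (yr a); nra.
rewrite (bigD1 a) //=.
apply: le_trans (_ : d a * r a + (D - d a) / N <= _); last by rewrite lerD2l.
have D0 : 0 <= D by apply: sumr_ge0.
have da := d0 a; have daD := dD a; have Ma := M0 a.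
rewrite -(ler_pM2r N0) mulrDl divfK ?gt_eqF //.
have -> : D / (1 + D) * r a * N = D * (r a * N) / (1 + D) by ring.
rewrite ler_pdivrMr ?ltr_wpDr //; set q := r a * N.
have q0 : 0 < q by rewrite mulr_gt0.
have -> : d a * r a * N = d a * q by rewrite /q mulrA.
have q1 : 1 <= q by have := rN a; rewrite ler_pdivrMr.
have H1 : 0 <= (D - d a) * (1 + D - d a - q * (1 - d a)).
  by rewrite mulr_ge0 // subr_ge0.
have H2 : 0 <= d a * D * (q * (1 - d a) - (D - d a)).
  by rewrite !mulr_ge0 // subr_ge0; nra.
by rewrite -(ler_pM2r Ma); lra.
Qed.

End TruncatedSimplex.

(** * Affine functions on a body in Loewner position *)

Section Partition.
Context {R : realType} {n : nat}.
Implicit Types (K : set 'cV[R]_n) (p : 'cV[R]_(1 + n)).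

Lemma dot_hat p x : dot p (hat x) = p 0 0 + dot (dsubmx p) x.
Proof.
rewrite -{1}[p]vsubmxK /hat !dotE tr_col_mx mul_row_col mulmx1 mxE; congr (_ + _).
by rewrite !mxE; congr (p _ _); exact/val_inj.
Qed.

Lemma dot_selfE p : dot p p = p 0 0 ^+ 2 + dot (dsubmx p) (dsubmx p).
Proof.
rewrite -{1 2}[p]vsubmxK !dotE tr_col_mx mul_row_col mxE; congr (_ + _).
rewrite mxE big_ord1 !mxE expr2.
by congr (p _ _ * p _ _); exact/val_inj.
Qed.

Lemma dot_hat0 p : dot p (hat 0) = p 0 0.
Proof. by rewrite dot_hat dot0r addr0. Qed.

Lemma dot_hat_hat (x y : 'cV[R]_n) : dot (hat x) (hat y) = 1 + dot x y.
Proof. by rewrite dot_hat hat00 col_mxKd. Qed.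

Lemma continuous_dot_hat p : continuous (fun x : 'cV[R]_n => dot p (hat x)).
Proof.
have -> : (fun x : 'cV[R]_n => dot p (hat x)) =
    (fun x => p 0 0 + dot (dsubmx p) x).
  by apply/funext => x; rewrite dot_hat.
by apply: continuous_shift; exact: continuous_dotr.
Qed.

(** In expectation [q] becomes its constant term and [q^2] becomes
    [dot q q]. *)
Lemma loewner_quadratic K (I : finType) (q : I -> 'cV[R]_(1 + n)) (a c : I -> R) :
  loewner_position K ->
  (forall x, K x -> 0 <= \sum_b (a b * dot (q b) (hat x)
                                 - c b * dot (q b) (hat x) ^+ 2)) ->
  0 <= \sum_b (a b * q b 0 0 - c b * dot (q b) (q b)).
Proof.
move=> [KQ _] H.
pose Q := \sum_b (a b *: (q b *m (hat 0)^T) - c b *: (q b *m (q b)^T)).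
have trE (A : 'M[R]_(1 + n)) : \tr (Q *m A) = \sum_b
    (a b * ((hat 0)^T *m A *m q b) 0 0 - c b * ((q b)^T *m A *m q b) 0 0).
  rewrite /Q mulmx_suml raddf_sum; apply: eq_bigr => b _ /=.
  rewrite mulmxBl raddfB /= -!scalemxAl !mxtraceZ -!mulmxA.
  by rewrite ![\tr (q b *m _)]mxtrace_mulC !trace_mx11 !mulmxA.
have -> : \sum_b (a b * q b 0 0 - c b * dot (q b) (q b)) = \tr Q.
  rewrite -[Q]mulmx1 trE; apply: eq_bigr => b _.
  by rewrite !mulmx1 -!dotE [dot (hat 0) _]dotC dot_hat0.
apply: KQ => x Kx; rewrite trE.
have {}H := H x Kx; congr (0 <= _): H; apply: eq_bigr => b _.
rewrite /moment; congr (_ * _ - _ * _).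
  by rewrite mulmxA -mulmxA mxE big_ord1 -!dotE dot_hat_hat dot0l addr0 mul1r dotC.
by rewrite mulmxA -mulmxA mxE big_ord1 -!dotE [dot (hat x) _]dotC expr2.
Qed.

Lemma loewner_quadratic1 K (q : 'cV[R]_(1 + n)) (a c : R) :
  loewner_position K ->
  (forall x, K x -> 0 <= a * dot q (hat x) - c * dot q (hat x) ^+ 2) ->
  0 <= a * q 0 0 - c * dot q q.
Proof.
move=> LK H; have := @loewner_quadratic K 'I_1 (fun=> q) (fun=> a) (fun=> c) LK.
by rewrite big_ord1; apply=> x Kx; rewrite big_ord1; exact: H.
Qed.

(** Here [p 0 0] is the mean of [p].  The expectation of [p (M - p)] gives
    [dot p p <= M * p 0 0].  The last bound says that the mean is at least the
    fraction [1 / (n + 1)] of the maximum: the variance of [p] is at least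
    [(M - p 0 0)^2 / n] because [K] lies in the ball of radius [sqrt n]. *)
Lemma loewner_max K p : K !=set0 -> compact K -> loewner_position K -> p != 0 ->
  (forall x, K x -> 0 <= dot p (hat x)) ->
  exists z, let M := dot p (hat z) in
    [/\ K z, forall x, K x -> dot p (hat x) <= M,
        0 < p 0 0, dot p p <= M * p 0 0 & M <= (n%:R + 1) * p 0 0].
Proof.
move=> K0 cK LK p0 pK.
have [z Kz zmax] := compact_argmax K0 cK (@continuous_dot_hat p).
exists z; set M := dot p (hat z); rewrite /=.
have M0 : 0 <= M := pK _ Kz.
have y0 : 0 <= p 0 0.
  have := @loewner_quadratic1 K p 1 0 LK; rewrite mul0r subr0 mul1r; apply=> x Kx.
  by rewrite mul0r subr0 mul1r pK.
have pp : dot p p <= M * p 0 0.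
  rewrite -subr_ge0 -[X in _ - X]mul1r; apply: (loewner_quadratic1 LK) => x Kx.
  by rewrite mul1r expr2 -mulrBl mulr_ge0 ?pK // subr_ge0 zmax.
have pp0 : 0 < dot p p.
  rewrite lt_neqAle dot_ge0 andbT eq_sym.
  by apply/eqP => /dot_eq0 /eqP; exact/negP.
have yp : 0 < p 0 0.
  rewrite lt_neqAle y0 andbT eq_sym; apply/eqP => py.
  by move: pp; rewrite py mulr0 leNgt pp0.
split=> //; have [_ /(_ _ Kz) zn] := LK.
have n0 : 0 <= n%:R :> R by rewrite ler0n.
(* the gradient is at least (M - p 0 0) / sqrt n, since |z| <= sqrt n *)
pose g := dsubmx p.
have [My|My] := lerP M (p 0 0); first by nra.
have ME : M - p 0 0 = dot g z by rewrite /M dot_hat addrAC subrr add0r.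
have : (M - p 0 0) ^+ 2 <= dot g g * n%:R.
  rewrite ME; apply: le_trans (_ : (enorm g * enorm z) ^+ 2 <= _).
    rewrite ler_sqr ?nnegrE ?dot_cauchy //.
      by rewrite -ME subr_ge0 ltW.
    by rewrite mulr_ge0 ?enorm_ge0.
  by rewrite exprMn !enorm_sqr ler_wpM2l ?dot_ge0.
move: pp; rewrite dot_selfE -/g => pp Mg.
have d0 : 0 < M - p 0 0 by rewrite subr_gt0.
have : (M - p 0 0) * (M - p 0 0) <= n%:R * p 0 0 * (M - p 0 0).
  rewrite -expr2; apply: le_trans Mg _.
  have gy : dot g g <= p 0 0 * (M - p 0 0) by rewrite expr2 in pp; lra.
  by rewrite [leRHS](_ : _ = p 0 0 * (M - p 0 0) * n%:R) ?ler_wpM2r //; ring.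
by rewrite ler_pM2r //; lra.
Qed.

(** With [M_a], [y_a], [x_a] the maximum, the mean and the slope of [p_a], the
    expectation of [sum p_a (M_a - p_a) / y_a] is
    [sum M_a - 1 - sum x_a^2 / y_a], and [sum x_a^2 / y_a >= (sum x_a)^2].
    The expectation is nonnegative, and this alone forces [m = n + 1] and
    [D <= 2 eps] for [D = sum (1 - M_a)].  On the truncated simplex
    [p_a <= M_a] the integrand lies above a linear function, of expectation at
    least [D (1 - D) / (1 + D)], whence [2 D / (1 + D) <= 2 eps]. *)
Theorem loewner_partition K (m : nat) (p : 'I_m -> 'cV[R]_(1 + n)) (eps : R) :
  K !=set0 -> compact K -> loewner_position K ->
  (forall a, p a != 0) -> (forall a x, K x -> 0 <= dot (p a) (hat x)) ->
  \sum_a p a = hat 0 -> (m <= n.+1)%N -> 0 < eps < 1 / 2 ->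
  n%:R - 2 * eps <= (\sum_a enorm (dsubmx (p a))) ^+ 2 ->
  m = n.+1 /\ exists z : 'I_m -> 'cV[R]_n, (forall a, K (z a)) /\
    \sum_a (1 - dot (p a) (hat (z a))) <= eps / (1 - eps).
Proof.
move=> K0 cK LK p0 pK p1 mn /andP[eps0 eps1] gradn.
have /choice[z zP] := fun a => loewner_max K0 cK LK (p0 a) (pK a).
pose M a := dot (p a) (hat (z a)); pose y a := p a 0 0.
pose x a := enorm (dsubmx (p a)).
have Kz a : K (z a) by have [] := zP a.
have pM a w : K w -> dot (p a) (hat w) <= M a.
  by move=> Kw; have [_ zmax _ _ _] := zP a; exact: zmax.
have y0 a : 0 < y a by have [] := zP a.
have xM a : x a ^+ 2 + y a ^+ 2 <= M a * y a.
  by have [_ _ _ + _] := zP a; rewrite dot_selfE addrC /x enorm_sqr.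
have My a : M a <= (n%:R + 1) * y a by have [] := zP a.
have psum w : \sum_a dot (p a) (hat w) = 1.
  by rewrite -dot_suml p1 dot_hat_hat dot0l addr0.
have y1 : \sum_a y a = 1.
  by have := psum 0; under eq_bigr do rewrite dot_hat0.
pose d a := 1 - M a.
have d0 a : 0 <= d a.
  rewrite subr_ge0 -(psum (z a)) (bigD1 a) //= lerDl.
  by apply: sumr_ge0 => b _; exact: pK.
have xy : n%:R - 2 * eps <= \sum_a x a ^+ 2 / y a.
  apply: le_trans gradn _; set s := \sum_a _; rewrite -subr_ge0.
  have -> : \sum_a x a ^+ 2 / y a - s ^+ 2 = \sum_a (x a - s * y a) ^+ 2 / y a.
    have E a : (x a - s * y a) ^+ 2 / y a =
        x a ^+ 2 / y a - 2 * s * x a + s ^+ 2 * y a.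
      by field; rewrite gt_eqF.
    under [RHS]eq_bigr do rewrite E.
    rewrite big_split sumrB -!mulr_sumr y1 -/s /=; ring.
  by apply: sumr_ge0 => a _; rewrite divr_ge0 ?sqr_ge0 // ltW.
have xyM a : y a + x a ^+ 2 / y a <= M a.
  rewrite -(ler_pM2r (y0 a)) mulrDl divfK ?gt_eqF //.
  by have := xM a; rewrite [y a ^+ 2]expr2; lra.
have sumM : 1 + n%:R - 2 * eps <= \sum_a M a.
  apply: le_trans (ler_sum _ (fun a _ => xyM a)).
  by rewrite big_split /= y1; lra.
have sumd : \sum_a d a = m%:R - \sum_a M a.
  by rewrite sumrB sumr_const card_ord.
have mE : m = n.+1.
  apply/eqP; rewrite eqn_leq mn ltnNge; apply/negP => mn'.
  have : (m%:R : R) <= n%:R by rewrite ler_nat.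
  have : 0 <= \sum_a d a by apply: sumr_ge0.
  by rewrite sumd; lra.
split=> //; exists z; split=> //; rewrite -/(d _).
change (\sum_a d a <= eps / (1 - eps)).
set D := \sum_a d a in sumd *.
have mR : m%:R = 1 + n%:R :> R by rewrite mE -natr1 addrC.
have D1 : D < 1 by lra.
have D0 : 0 <= D by apply: sumr_ge0.
have [|||||beta [beta0 ybeta Dbeta]] := @max_ratio_bound R 'I_m y d.
- by rewrite card_ord mE.
- by [].
- by [].
- by [].
- by move=> a; rewrite card_ord mR /d subKr addrC; exact: My.
have dM a : 1 - d a = M a by rewrite /d subKr.
have M0 a : 0 < M a.
  have : d a <= D by rewrite /D (bigD1 a) //= lerDl sumr_ge0.
  by rewrite -dM; lra.
pose c := (1 - D) / beta.
have key : 0 <= \sum_a ((M a / y a - c * d a / M a) * y a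
                         - (y a)^-1 * dot (p a) (p a)).
  apply: (loewner_quadratic LK) => w Kw.
  have := @truncated_simplex_concavity R 'I_m (fun a => dot (p a) (hat w)) d.
  rewrite -/D => /(_ (fun a => pK a w Kw) (psum w) d0 _ D1) H.
  have {}H : 0 <= \sum_a dot (p a) (hat w) *
      (1 - d a - dot (p a) (hat w) - (1 - D) * d a) / (1 - d a).
    by apply: H => a; rewrite dM pM.
  apply: le_trans (mulr_ge0 (ltW (_ : 0 < beta^-1)) H) _.
    by rewrite invr_gt0.
  rewrite mulr_sumr; apply: ler_sum => a _; rewrite !dM.
  set P := dot (p a) (hat w).
  have P0 : 0 <= P * (M a - P) by rewrite mulr_ge0 ?pK // subr_ge0 pM.
  have yM : (beta * M a)^-1 <= (y a)^-1.
    rewrite lef_pV2 ?posrE ?mulr_gt0 //.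
    by have := ybeta a; rewrite dM.
  rewrite -subr_ge0.
  have -> : (M a / y a - c * d a / M a) * P - (y a)^-1 * P ^+ 2
     - beta^-1 * (P * (M a - P - (1 - D) * d a) / M a)
    = P * (M a - P) * ((y a)^-1 - (beta * M a)^-1).
    by rewrite /c; field; rewrite !gt_eqF.
  by rewrite mulr_ge0 // subr_ge0.
have E a : (M a / y a - c * d a / M a) * y a - (y a)^-1 * dot (p a) (p a) =
    M a - y a - x a ^+ 2 / y a - c * (d a * y a / M a).
  rewrite dot_selfE -enorm_sqr -/(y a) -/(x a); field.
  by rewrite !gt_eqF.
move: key; under eq_bigr do rewrite E.
rewrite sumrB sumrB sumrB y1 -mulr_sumr.
have c0 : 0 <= c by rewrite divr_ge0 // ?subr_ge0 ltW.
have := ler_wpM2l c0 Dbeta; rewrite -/D.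
have -> : \sum_b d b * y b / (1 - d b) = \sum_a d a * y a / M a.
  by apply: eq_bigr => a _; rewrite dM.
have -> : c * (D / (1 + D) * beta) = (1 - D) * D / (1 + D).
  by rewrite /c; field; rewrite !gt_eqF ?ltr_wpDr.
move=> H1 H2.
have : D + (1 - D) * D / (1 + D) <= 2 * eps by lra.
have -> : D + (1 - D) * D / (1 + D) = 2 * D / (1 + D).
  by field; rewrite gt_eqF ?ltr_wpDr.
rewrite ler_pdivrMr ?ltr_wpDr // ler_pdivlMr; lra.
Qed.

End Partition.

(** * Partitions of unity into steep affine functions *)

Section PartitionExistence.
Context {R : realType} {n : nat}.
Implicit Types (K : set 'cV[R]_n) (p : 'cV[R]_(1 + n)).

Definition nonneg_on K p : Prop := forall x, K x -> 0 <= dot p (hat x).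

Definition affine_partition K (m : nat) (p : 'I_m -> 'cV[R]_(1 + n)) : Prop :=
  (forall a, nonneg_on K (p a)) /\ \sum_a p a = hat 0.

Definition total_slope (m : nat) (p : 'I_m -> 'cV[R]_(1 + n)) : R :=
  \sum_a enorm (dsubmx (p a)).

Lemma nonneg_onZ K a p : 0 <= a -> nonneg_on K p -> nonneg_on K (a *: p).
Proof. by move=> a0 pK x Kx; rewrite dotZl mulr_ge0 ?pK. Qed.

(** The cone generated by the pairs (slope of [p], [p]), with [p] nonnegative on
    [K]; it is closed downwards in the slope coordinate so that separating
    functionals are decreasing in it. *)
Definition slope_cone K : set 'cV[R]_(1 + (1 + n)) :=
  [set w : 'cV[R]_(1 + (1 + n)) | exists2 s : seq 'cV[R]_(1 + n),
     (forall p, p \in s -> nonneg_on K p) &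
     dsubmx w = \sum_(p <- s) p /\ w 0 0 <= \sum_(p <- s) enorm (dsubmx p)].

Lemma slope_coneZ K a w : 0 <= a -> slope_cone K w -> slope_cone K (a *: w).
Proof.
move=> a0 [s sK [ws wt]]; exists [seq a *: p | p <- s].
  by move=> _ /mapP [p ps ->]; apply: nonneg_onZ => //; exact: sK.
split; first by rewrite linearZ /= ws big_map scaler_sumr.
rewrite mxE big_map (le_trans (ler_wpM2l a0 wt)) // mulr_sumr.
by apply: ler_sum => p _; rewrite linearZ /= enormZ.
Qed.

Lemma slope_coneD K w w' : slope_cone K w -> slope_cone K w' ->
  slope_cone K (w + w').
Proof.
move=> [s sK [ws wt]] [s' s'K [ws' wt']]; exists (s ++ s').
  by move=> p; rewrite mem_cat => /orP [/sK|/s'K].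
by rewrite linearD /= ws ws' !big_cat mxE /=; split=> //; rewrite lerD.
Qed.

Lemma separating_functional K (X : R) : 0 < X ->
  ~ closure (slope_cone K) (col_mx X%:M (hat 0)) ->
  exists (s : R) (a : 'cV[R]_(1 + n)), [/\ 0 < s, a 0 0 < s * X &
    forall p, nonneg_on K p -> s * enorm (dsubmx p) <= dot a p].
Proof.
move=> X0 nW.
have W0 : slope_cone K 0.
  by exists [::] => //; rewrite !big_nil linear0 mxE.
have cW : convexly_closed (slope_cone K).
  move=> x y t /andP[t0 t1] Wx Wy; apply: slope_coneD; apply: slope_coneZ => //.
  by rewrite subr_ge0.
have [v [c [vX vW]]] := separation (@closed_closure _ _)
  (ex_intro _ _ (subset_closure W0)) (convexly_closed_closure cW) nW.
have c0 : c <= 0 by rewrite -(dot0r v); apply: vW; exact: subset_closure.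
have {}vW w : slope_cone K w -> 0 <= dot v w.
  move=> Ww; rewrite leNgt; apply/negP => vw.
  have k0 : 0 <= (c - 1) / dot v w.
    by rewrite -mulrNN -invrN divr_ge0 // ?oppr_ge0 ?ltW //; lra.
  have := vW _ (subset_closure (slope_coneZ k0 Ww)).
  by rewrite dotZr divfK ?lt_eqF //; lra.
have dotv w : dot v w = v 0 0 * w 0 0 + dot (dsubmx v) (dsubmx w).
  rewrite -{1}[v]vsubmxK -{1}[w]vsubmxK !dotE tr_col_mx mul_row_col mxE.
  congr (_ + _); rewrite mxE big_ord1 !mxE.
  by congr (v _ _ * w _ _); exact/val_inj.
have s0 : 0 <= - v 0 0.
  have := vW (col_mx (-1)%:M 0); rewrite dotv col_mxKd dot0r addr0.
  have -> : (col_mx (-1)%:M 0 : 'cV[R]_(1 + (1 + n))) 0 0 = -1.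
    by rewrite mxE; case: splitP => [j _|//]; rewrite ord1 mxE eqxx.
  rewrite mulrN1; apply; exists [::] => //; rewrite col_mxKd !big_nil; split=> //.
  by rewrite mxE; case: splitP => [j _|//]; rewrite ord1 mxE eqxx mulr1n lerN10.
have single p : nonneg_on K p ->
    - v 0 0 * enorm (dsubmx p) <= dot (dsubmx v) p.
  move=> pK; pose w : 'cV[R]_(1 + (1 + n)) := col_mx (enorm (dsubmx p))%:M p.
  have w0 : w 0 0 = enorm (dsubmx p).
    by rewrite mxE; case: splitP => [j _|//]; rewrite ord1 mxE eqxx.
  have := vW w; rewrite dotv w0 col_mxKd => H.
  rewrite mulNr -subr_ge0 opprK addrC; apply: H.
  exists [:: p] => [q|]; first by rewrite inE => /eqP ->.
  by rewrite w0 col_mxKd !big_seq1.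
have a1 : 0 <= dsubmx v 0 0.
  have := single (hat 0); rewrite dot_hat0 col_mxKd /enorm dot0r sqrtr0 mulr0.
  by apply=> x _; rewrite dot_hat_hat dot0l addr0.
have aX : v 0 0 * X + dsubmx v 0 0 < 0.
  have := lt_le_trans vX c0; rewrite dotv col_mxKd [dot _ (hat 0)]dot_hat0.
  suff -> : (col_mx X%:M (hat 0) : 'cV[R]_(1 + (1 + n))) 0 0 = X by [].
  by rewrite mxE; case: splitP => [j _|//]; rewrite ord1 mxE eqxx.
exists (- v 0 0), (dsubmx v); split=> //; last by lra.
rewrite lt_neqAle s0 andbT eq_sym; apply/eqP => v0; move: aX a1; nra.
Qed.

(** Up to scaling, a functional that is positive on the affine functions
    nonnegative on [K] is the evaluation at a point; the slack [s * enorm]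
    leaves room for a ball around this point. *)
Lemma ball_of_functional K (s : R) (a : 'cV[R]_(1 + n)) :
  (0 < n)%N -> compact K -> K !=set0 -> convexly_closed K -> 0 < s ->
  (forall p, nonneg_on K p -> s * enorm (dsubmx p) <= dot a p) ->
  0 < a 0 0 /\ forall x, enorm (x - (a 0 0)^-1 *: dsubmx a) <= s / a 0 0 -> K x.
Proof.
move=> n0 cK K0 cvK s0 aP.
have dota c g : dot a (col_mx c%:M g) = a 0 0 * c + dot (dsubmx a) g.
  rewrite -{1}[a]vsubmxK !dotE tr_col_mx mul_row_col mxE mul_mx_scalar.
  congr (_ + _); rewrite !mxE mulrC.
  by congr (a _ _ * _); exact/val_inj.
have dothat c g (x : 'cV[R]_n) : dot (col_mx c%:M g) (hat x) = c + dot g x.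
  rewrite dot_hat col_mxKd; congr (_ + _).
  by rewrite mxE; case: splitP => [j _|//]; rewrite ord1 mxE eqxx.
have a0 : 0 < a 0 0.
  have a0 : 0 <= a 0 0.
    have := aP (col_mx 1%:M 0); rewrite dota dot0r addr0 mulr1 col_mxKd.
    rewrite /enorm dot0r sqrtr0 mulr0; apply=> x _.
    by rewrite dothat dot0l addr0.
  rewrite lt_neqAle a0 andbT eq_sym; apply/eqP => a00.
  pose g : 'cV[R]_n := delta_mx (Ordinal n0) 0.
  have sl h : s * enorm h <= dot (dsubmx a) h.
    have [z Kz zmax] := compact_argmax K0 cK (@continuous_dotr R n (- h)).
    have := aP (col_mx (dot (- h) z)%:M h); rewrite dota a00 mul0r add0r col_mxKd.
    apply=> x Kx; rewrite dothat; have := zmax _ Kx; rewrite !dotNl; lra.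
  have g0 : 0 < enorm g.
    apply: lt_le_trans (enorm_coord g (Ordinal n0)).
    by rewrite mxE !eqxx normr1.
  have := sl g; have := sl (- g).
  rewrite /enorm dotNl !dotNr opprK -/(enorm g).
  by have := mulr_gt0 s0 g0; lra.
split=> // x xr; apply: contrapT => nKx.
have [v [c [vx vK]]] := separation (compact_mx_closed cK) K0 cvK nKx.
have := aP (col_mx (- c)%:M v); rewrite dota col_mxKd => H.
have {}H : s * enorm v <= a 0 0 * - c + dot (dsubmx a) v.
  by apply: H => y Ky; rewrite dothat; have := vK y Ky; lra.
set y := _ *: dsubmx a in xr.
have vy : a 0 0 * dot v y = dot (dsubmx a) v.
  by rewrite /y dotZr mulrA divff ?gt_eqF // mul1r dotC.
have := dot_cauchy (- v) (x - y); rewrite dotNl dotBr.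
have -> : enorm (- v) = enorm v by rewrite /enorm dotNl dotNr opprK.
move=> H2; have := ler_wpM2l (enorm_ge0 v) xr.
have : a 0 0 * (enorm v * (s / a 0 0)) = s * enorm v.
  by field; rewrite gt_eqF.
by nra.
Qed.

(** Linear programming duality for the inradius: if [K] contains no ball of
    radius larger than [1 / X], then total slopes arbitrarily close to [X] are
    reached by partitions of unity into affine functions nonnegative on [K]. *)
Lemma steep_partition K (X Y : R) :
  (0 < n)%N -> compact K -> K !=set0 -> convexly_closed K -> 0 <= Y < X ->
  (forall y r, (forall x, enorm (x - y) <= r -> K x) -> r <= X^-1) ->
  exists (m : nat) (p : 'I_m -> 'cV[R]_(1 + n)),
    affine_partition K p /\ Y <= total_slope p.
Proof.
move=> n0 cK K0 cvK /andP[Y0 YX] noball.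
have X0 : 0 < X := le_lt_trans Y0 YX.
have [|/(separating_functional X0) [s [a [s0 aX aP]]]] :=
  pselect (closure (slope_cone K) (col_mx X%:M (hat 0))); last first.
  have [a0 /noball] := ball_of_functional n0 cK K0 cvK s0 aP.
  by rewrite ler_pdivrMr // mulrC ler_pdivlMr // leNgt aX.
move=> /closure_mxP Wcl.
have [b b0 Kb] := compact_mx_bounded cK.
pose B := Num.max 1 b; have B1 : 1 <= B by rewrite le_max lexx.
have hB x i : K x -> `|hat x i 0| <= B.
  move=> Kx; rewrite /hat mxE; case: splitP => j _; rewrite le_max.
    by rewrite mxE ord1 eqxx normr1 lexx.
  by rewrite Kb ?orbT.
pose tau := (X - Y) / (2 * (Y + 1)).
have tau0 : 0 < tau by rewrite divr_gt0 ?mulr_gt0 ?subr_gt0 // ltr_wpDl.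
have tauY : Y * tau <= (X - Y) / 2.
  rewrite /tau mulrA ler_pdivrMr ?mulr_gt0 ?ltr_wpDl //; nra.
have nB0 : 0 < (1 + n)%:R * B.
  apply: mulr_gt0; first by rewrite ltr0n.
  exact: lt_le_trans B1.
pose e := Num.min ((X - Y) / 2) (tau / ((1 + n)%:R * B)).
have e0 : 0 < e.
  rewrite lt_min; apply/andP; split; last exact: divr_gt0.
  by rewrite divr_gt0 // subr_gt0.
have e1 : e <= (X - Y) / 2 by rewrite ge_min lexx.
have e2 : (1 + n)%:R * B * e <= tau.
  by rewrite mulrC -ler_pdivlMr // ge_min lexx orbT.
have [w [s sK [ws wt]] we] := Wcl e e0.
(* absorb the error into one more affine function *)
pose q := (1 + tau) *: hat 0 - dsubmx w.
have qK : nonneg_on K q.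
  move=> x Kx; rewrite /q scalerDl scale1r addrAC dotDl dotZl dot_hat_hat.
  rewrite dot0l addr0 mulr1.
  suff : `|dot (hat 0 - dsubmx w) (hat x)| <= tau by rewrite ler_norml; lra.
  apply: le_trans e2; rewrite /dot (le_trans (ler_norm_sum _ _ _)) //.
  apply: le_trans (_ : \sum_(i < 1 + n) B * e <= _); last first.
    by rewrite sumr_const card_ord -[leLHS]mulr_natl mulrA.
  apply: ler_sum => i _; rewrite normrM mulrC ler_pM ?hB //.
  have := we (rshift 1 i); rewrite col_mxEd => /ltW.
  by rewrite !mxE.
have k0 : 0 < 1 + tau by rewrite ltr_wpDl.
pose t := [seq (1 + tau)^-1 *: p | p <- q :: s].
have tK p : p \in t -> nonneg_on K p.
  move=> /mapP [p' p's ->]; apply: nonneg_onZ; first by rewrite invr_ge0 ltW.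
  by move: p's; rewrite inE => /orP [/eqP -> //|/sK].
exists (size t), (tnth (in_tuple t)); split; first split.
- by move=> a; apply: tK; exact: mem_tnth.
- rewrite -(big_tnth _ _ t xpredT id) big_map -scaler_sumr big_cons -ws /q subrK.
  by rewrite scalerA mulVf ?scale1r // gt_eqF.
rewrite /total_slope -(big_tnth _ _ t xpredT (fun p => enorm (dsubmx p))) big_map.
under eq_bigr do rewrite linearZ /= enormZ ?invr_ge0 ?(ltW k0) //.
rewrite -mulr_sumr mulrC ler_pdivlMr // big_cons.
apply: le_trans (_ : w 0 0 <= _); last first.
  by apply: le_trans wt _; rewrite lerDr enorm_ge0.
have := we 0.
suff -> : (col_mx X%:M (hat 0) : 'cV[R]_(1 + (1 + n))) 0 0 = X.
  by rewrite ltr_norml => /andP[_]; lra.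
by rewrite mxE; case: splitP => [j _|//]; rewrite ord1 mxE eqxx.
Qed.

Lemma affine_partition_lift K (m : nat) (p : 'I_m.+1 -> 'cV[R]_(1 + n)) a :
  affine_partition K p -> p a = 0 ->
  affine_partition K (fun b => p (lift a b)) /\
  total_slope (fun b => p (lift a b)) = total_slope p.
Proof.
move=> [pK p1] pa; split; first split=> [b|]; first exact: pK.
  by move: p1; rewrite (bigD1_ord a) //= pa add0r.
rewrite /total_slope [RHS](bigD1_ord a) //= pa linear0 /enorm dot0r sqrtr0.
by rewrite add0r.
Qed.

(** Along a linear dependency the total slope varies linearly as long as no
    function changes sign, so one of the functions can be made to vanish
    without decreasing the total slope. *)
Lemma affine_partition_shrink K (m : nat) (p : 'I_m -> 'cV[R]_(1 + n)) :
  compact K -> K !=set0 -> loewner_position K ->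
  affine_partition K p -> (forall a, p a != 0) -> (n.+1 < m)%N ->
  exists (p' : 'I_m -> 'cV[R]_(1 + n)) (a : 'I_m),
    [/\ affine_partition K p', p' a = 0 & total_slope p <= total_slope p'].
Proof.
move=> cK K0 LK [pK p1] p0 mn.
have y0 a : 0 < p a 0 0.
  by have [z []] := loewner_max K0 cK LK (p0 a) (pK a).
pose P : 'M[R]_(m, 1 + n) := \matrix_(a, i) p a i 0.
have : kermx P != 0.
  rewrite kermx_eq0 -row_leq_rank -ltnNge (leq_ltn_trans (rank_leq_col P)) //.
move=> /rowV0Pn [k0 /sub_kermxP k0P k00].
have [k [kP k0' ks]] : exists k : 'I_m -> R, [/\ \sum_a k a *: p a = 0,
    exists a, k a != 0 & 0 <= \sum_a k a * enorm (dsubmx (p a))].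
  have k0p : \sum_a k0 0 a *: p a = 0.
    apply/matrixP => i j; rewrite ord1 summxE [RHS]mxE.
    have E : (k0 *m P) 0 i = 0 by rewrite k0P mxE.
    by rewrite -[RHS]E mxE; apply: eq_bigr => a _; rewrite !mxE.
  have [a ka] : exists a, k0 0 a != 0.
    apply: contrapT => H; move/eqP: k00; apply; apply/matrixP => i a.
    rewrite ord1 mxE; apply/eqP; apply: contrapT => /negP ka.
    by apply: H; exists a.
  have [s|s] := lerP 0 (\sum_a k0 0 a * enorm (dsubmx (p a))).
    by exists (fun a => k0 0 a); split=> //; exists a.
  exists (fun a => - k0 0 a); split; last 2 first.
  - by exists a; rewrite oppr_eq0.
  - by under eq_bigr do rewrite mulNr; rewrite sumrN oppr_ge0 ltW.
  by under eq_bigr do rewrite scaleNr; rewrite sumrN k0p oppr0.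
have [a0 ka0] := k0'.
pose a := [arg min_(b < a0) k b]%O.
have ka b : k a <= k b by rewrite /a; case: arg_minP => // i _; exact.
have kneg : k a < 0.
  rewrite ltNge; apply/negP => kpos.
  have : \sum_b k b * p b 0 0 = 0.
    have E : (\sum_b k b *: p b) 0 0 = 0 by rewrite kP mxE.
    by rewrite -[RHS]E summxE; apply: eq_bigr => b _; rewrite mxE.
  move/eqP; rewrite psumr_eq0 => [|b _]; last first.
    by apply: mulr_ge0; [exact: le_trans (ka b)|exact: ltW].
  move=> /allP /(_ a0 (mem_index_enum _)) /=.
  by rewrite mulf_eq0 (negPf ka0) gt_eqF.
have coef b : 0 <= 1 - k b / k a.
  by rewrite subr_ge0 ler_ndivrMr // mul1r.
exists (fun b => (1 - k b / k a) *: p b), a; split.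
- split=> [b|]; first exact: nonneg_onZ.
  under eq_bigr do rewrite scalerBl scale1r mulrC -scalerA.
  by rewrite sumrB -scaler_sumr kP scaler0 subr0.
- by rewrite divff ?lt_eqF // subrr scale0r.
rewrite /total_slope; under [leRHS]eq_bigr do rewrite linearZ /= enormZ //.
under [leRHS]eq_bigr do rewrite mulrBl mul1r mulrAC.
rewrite sumrB -mulr_suml lerBrDr gerDl mulr_ge0_le0 //.
by rewrite invr_le0 ltW.
Qed.

Lemma small_partition K (m : nat) (p : 'I_m -> 'cV[R]_(1 + n)) (Y : R) :
  compact K -> K !=set0 -> loewner_position K ->
  affine_partition K p -> Y <= total_slope p ->
  exists (m' : nat) (p' : 'I_m' -> 'cV[R]_(1 + n)),
    [/\ affine_partition K p', Y <= total_slope p', forall a, p' a != 0 &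
        (m' <= n.+1)%N].
Proof.
move=> cK K0 LK; elim: m p => [|m IH] p pP pY; first by exists 0%N, p; split=> // -[].
have [pn0|] := boolP [forall a, p a != 0]; last first.
  rewrite negb_forall => /existsP [a]; rewrite negbK => /eqP pa.
  have [lP lY] := affine_partition_lift pP pa.
  by apply: IH lP _; rewrite lY.
have [mn|mn] := leqP m.+1 n.+1.
  by exists m.+1, p; split=> //; exact/forallP.
have [p' [a [p'P p'a p'Y]]] := affine_partition_shrink cK K0 LK pP (forallP pn0) mn.
have [lP lY] := affine_partition_lift p'P p'a.
by apply: IH lP _; rewrite lY (le_trans pY).
Qed.

End PartitionExistence.

(** * Banach-Mazur ratios and simplices *)

Section BanachMazur.
Context {R : realType} {n : nat}.
Implicit Types (K L S : set 'cV[R]_n).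

Definition bm_ratio K L (rho : R) : Prop := 0 <= rho /\
  exists (A : 'M[R]_n) (u v : 'cV[R]_n),
    [/\ A \in unitmx,
        [set u + x | x in K] `<=` [set A *m x | x in L] &
        [set A *m x | x in L] `<=` [set v + rho *: x | x in K]].

Lemma banach_mazur_le K L rho : bm_ratio K L rho -> banach_mazur K L <= rho.
Proof. by move=> H; apply: ge_inf => //; exists 0 => r []. Qed.

Lemma le_banach_mazur K L b : (exists rho, bm_ratio K L rho) ->
  (forall rho, bm_ratio K L rho -> b <= rho) -> b <= banach_mazur K L.
Proof. by move=> [r Hr] H; apply: lb_le_inf; [exists r|move=> ? /H]. Qed.

Lemma bm_ratio_affine K L (A0 : 'M[R]_n) (c : 'cV[R]_n) rho :
  A0 \in unitmx ->
  bm_ratio [set w | K (A0 *m w + c)] L rho -> bm_ratio K L rho.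
Proof.
move=> A0U [rho0 [A [u [v [AU KA AK]]]]]; split=> //.
exists (A0 *m A), (A0 *m u - c), (A0 *m v - rho *: c); split.
- by rewrite unitmx_mul A0U.
- move=> _ [x Kx <-].
  have [|l Ll Al] := KA (u + invmx A0 *m (x - c)).
    by exists (invmx A0 *m (x - c)) => //=; rewrite mulKVmx // subrK.
  exists l => //; rewrite -mulmxA Al mulmxDr mulKVmx //.
  by rewrite addrA addrAC.
move=> _ [l Ll <-]; have [|w Kw wE] := AK (A *m l); first by exists l.
exists (A0 *m w + c) => //; rewrite -mulmxA -wE mulmxDr -scalemxAr scalerDr.
by rewrite addrACA addNr addr0.
Qed.

Lemma euclidean_ballE (x : 'cV[R]_n) : euclidean_ball R n x = (enorm x <= 1).
Proof. by rewrite /euclidean_ball /enorm /dot /=; under eq_bigr do rewrite expr2. Qed.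

Lemma bm_ratio_ball K (y : 'cV[R]_n) (r s : R) : 0 < r -> 0 < s ->
  (forall x, enorm (x - y) <= r -> K x) -> (forall x, K x -> enorm x <= s) ->
  bm_ratio K (euclidean_ball R n) (s / r).
Proof.
move=> r0 s0 yK Ks; split; first by rewrite divr_ge0 // ltW.
have s0' : s != 0 by rewrite gt_eqF.
exists s%:M, 0, (- (s / r) *: y); split.
- by rewrite unitmxE det_scalar unitrX // unitfE.
- move=> _ [x Kx <-]; exists (s^-1 *: x).
    rewrite euclidean_ballE enormZ ?invr_ge0; last exact: ltW.
    by rewrite ler_pdivrMl // mulr1 Ks.
  by rewrite mul_scalar_mx scalerA divff // scale1r add0r.
move=> _ [x + <-]; rewrite euclidean_ballE => x1.
exists (y + r *: x).
  apply: yK; rewrite addrAC subrr add0r enormZ ?(ltW r0) //.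
  by rewrite ger_pMr.
rewrite mul_scalar_mx scalerDr scalerA scaleNr addKr.
by congr (_ *: _); field; rewrite gt_eqF.
Qed.

End BanachMazur.

Section Simplices.
Context {R : realType} {n : nat}.
Implicit Types (K S : set 'cV[R]_n).

Lemma convexly_closed_sum (m : nat) (C : set 'cV[R]_m) (k : nat)
    (q : 'I_k -> 'cV[R]_m) (a : 'I_k -> R) :
  convexly_closed C -> (forall i, C (q i)) -> (forall i, 0 <= a i) ->
  \sum_i a i = 1 -> C (\sum_i a i *: q i).
Proof.
move=> cC; elim: k q a => [|k IH] q a qC a0.
  by rewrite big_ord0 => /eqP; rewrite eq_sym oner_eq0.
rewrite !big_ord_recl => a1; set b := \sum_(i < k) a (lift ord0 i) in a1.
have b0 : 0 <= b by apply: sumr_ge0.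
have [bE|bn0] := eqVneq b 0.
  rewrite big1 ?addr0 => [|i _].
    by move: a1; rewrite bE addr0 => ->; rewrite scale1r.
  move/eqP: bE; rewrite psumr_eq0 => [/allP|//].
  by move=> /(_ i (mem_index_enum _)) /eqP ->; rewrite scale0r.
have -> : \sum_(i < k) a (lift ord0 i) *: q (lift ord0 i) =
    (1 - a ord0) *: \sum_(i < k) (a (lift ord0 i) / b) *: q (lift ord0 i).
  rewrite -a1 addrAC subrr add0r scaler_sumr; apply: eq_bigr => i _.
  by rewrite scalerA mulrCA divff ?mulr1.
apply: cC => //; first by rewrite a0 -a1 lerDl.
apply: IH => [i|i|]; [exact: qC|exact: divr_ge0|].
by rewrite -mulr_suml divff.
Qed.

(** The matrices that send [hat x] to the barycentric coordinates of [x] with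
    respect to some simplex. *)
Definition bary_matrix (F : 'M[R]_(1 + n)) : Prop :=
  F \in unitmx /\ forall x : 'cV[R]_n, \sum_i (F *m hat x) i 0 = 1.

Lemma simplex_bary S : is_simplex S ->
  exists F, bary_matrix F /\ S = [set x | forall i, 0 <= (F *m hat x) i 0].
Proof.
move=> [q [aff ->]].
pose H : 'M[R]_(1 + n) := \matrix_(i, a) hat (q a) i 0.
have Hmul (l : 'cV[R]_(1 + n)) :
    H *m l = col_mx (\sum_a l a 0)%:M (\sum_a l a 0 *: q a).
  apply/matrixP => i j; rewrite ord1 mxE [RHS]mxE; case: splitP => k ik.
    rewrite ord1 mxE eqxx; apply: eq_bigr => a _.
    rewrite !mxE; case: splitP ik => [j' _ _|j' ->]; last by rewrite (ord1 k).
    by rewrite ord1 mxE eqxx mul1r.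
  rewrite summxE; apply: eq_bigr => a _; rewrite !mxE mulrC.
  case: splitP ik => [j' -> /= ik|j' -> /= [/val_inj ->] //].
  by have := ltn_ord j'; rewrite ik.
have HU : H \in unitmx.
  rewrite -unitmx_tr unitmxE unitfE; apply/negP => /det0P [v v0 vH].
  have := Hmul v^T; rewrite -[H]trmxK -trmx_mul vH trmx0 => Hv.
  move/eqP: v0; apply; apply: trmx_inj; rewrite trmx0.
  apply/matrixP => a j; rewrite ord1 [RHS]mxE.
  apply: (aff (fun a => v^T a 0)).
    have := congr1 usubmx Hv; rewrite col_mxKu linear0 => /matrixP /(_ 0 0).
    by rewrite [LHS]mxE [RHS]mxE eqxx mulr1n => <-.
  by have := congr1 dsubmx Hv; rewrite col_mxKd linear0.
exists (invmx H); split.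
  split=> [|x]; first by rewrite unitmx_inv.
  have := Hmul (invmx H *m hat x); rewrite mulKVmx // => /(congr1 usubmx).
  by rewrite !col_mxKu => /matrixP /(_ 0 0); rewrite [LHS]mxE [RHS]mxE eqxx.
rewrite /convex_hull; apply/seteqP; split => [x|x /= xF].
  apply; split.
    apply/convex_setP => y z t /andP[t0 t1] yF zF i /=.
    have -> : hat (t *: y + (1 - t) *: z) = t *: hat y + (1 - t) *: hat z.
      rewrite /hat !scale_col_mx add_col_mx -scalerDl [t + _]addrC subrK scale1r.
      by [].
    rewrite mulmxDr -!scalemxAr !mxE; apply: addr_ge0; apply: mulr_ge0 => //.
    - by have := yF i; rewrite mxE.
    - by rewrite subr_ge0.
    - by have := zF i; rewrite mxE.
  move=> _ [a _ <-] i /=.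
  have -> : hat (q a) = H *m delta_mx a 0.
    by apply/matrixP => k l; rewrite ord1 -colE !mxE.
  by rewrite mulKmx // mxE ler0n.
move=> C [/convex_setP cC qC].
have := Hmul (invmx H *m hat x); rewrite mulKVmx // => Hx.
have := congr1 dsubmx Hx; rewrite !col_mxKd => ->.
apply: convexly_closed_sum => // [i|].
  by apply: qC; exists i.
have := congr1 usubmx Hx; rewrite !col_mxKu => /matrixP /(_ 0 0).
by rewrite [LHS]mxE [RHS]mxE eqxx.
Qed.

End Simplices.

(** * From a partition of unity to a sandwich between simplices *)

(** Farkas certificate that the point with barycentric coordinates [t] lies in
    the convex hull of the columns of the stochastic matrix [P]: a functional
    that is nonnegative on the columns is nonnegative at [t].  The proof
    compares every value of the functional with its smallest one [l k]. *)
Lemma stochastic_hull (R : realFieldType) (I : finType) (P : I -> I -> R)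
    (l t : I -> R) (k0 : I) :
  (forall i j, 0 <= P i j) -> (forall j, \sum_i P i j = 1) ->
  (forall i, \sum_(j | j != i) P i j <= t i) -> \sum_i t i = 1 ->
  (forall j, 0 <= \sum_i l i * P i j) -> 0 <= \sum_i l i * t i.
Proof.
move=> P0 P1 st t1 lP; pose s i := \sum_(j | j != i) P i j.
pose k := [arg min_(i < k0) l i]%O.
have lk i : l k <= l i by rewrite /k; case: arg_minP => // j _; exact.
have col j : \sum_(i | i != j) P i j = 1 - P j j.
  by rewrite -(P1 j) [in RHS](bigD1 j) //= addrAC subrr add0r.
have swap (f : I -> R) :
    \sum_i f i * s i = \sum_j \sum_(i | i != j) f i * P i j.
  rewrite /s; under eq_bigr do rewrite mulr_sumr.
  rewrite (exchange_big_dep xpredT) //=; apply: eq_bigr => j _.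
  by apply: eq_bigl => i; rewrite eq_sym.
pose D := \sum_j (1 - P j j).
have sD : \sum_i s i = D.
  have := swap (fun=> 1); under eq_bigr do rewrite mul1r; move=> ->.
  by apply: eq_bigr => j _; under eq_bigr do rewrite mul1r; exact: col.
have ls : l k * (D - 1) <= \sum_i l i * s i.
  rewrite swap (bigD1 k) //= /D (bigD1 k) //=.
  have h1 : - (l k * P k k) <= \sum_(i | i != k) l i * P i k.
    by have := lP k; rewrite (bigD1 k) //=; lra.
  have h2 : l k * \sum_(j | j != k) (1 - P j j) <=
      \sum_(j | j != k) \sum_(i | i != j) l i * P i j.
    rewrite mulr_sumr; apply: ler_sum => j _; rewrite -col mulr_sumr.
    by apply: ler_sum => i _; rewrite ler_wpM2r.
  by lra.
have lt : 0 <= \sum_i (l i - l k) * (t i - s i).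
  by apply: sumr_ge0 => i _; rewrite mulr_ge0 // subr_ge0 ?lk ?st.
have E i : (l i - l k) * (t i - s i) =
  l i * t i - l i * s i - l k * t i + l k * s i by ring.
move: lt; under eq_bigr do rewrite E.
rewrite big_split /= !sumrB -!mulr_sumr t1 sD; lra.
Qed.

Section Sandwich.
Context {R : realType} {n : nat}.
Implicit Types (K S : set 'cV[R]_n).

Definition partition_matrix (p : 'I_n.+1 -> 'cV[R]_(1 + n)) : 'M[R]_(1 + n) :=
  \matrix_(a, i) p a i 0.

Lemma partition_matrixE p (x : 'cV[R]_(1 + n)) a :
  (partition_matrix p *m x) a 0 = dot (p a) x.
Proof. by rewrite mxE; apply: eq_bigr => i _; rewrite mxE. Qed.

Lemma mul_partition_matrix p (l : 'rV[R]_(1 + n)) :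
  (l *m partition_matrix p)^T = \sum_a l 0 a *: p a.
Proof.
apply/matrixP => i j; rewrite ord1 summxE !mxE.
by apply: eq_bigr => a _; rewrite !mxE.
Qed.

(** If [sum l_a p_a = 0], both [l] and [- l] are nonnegative on the columns of
    the matrix of values [p_i (z_j)], so [l] vanishes at every vertex of the
    inner simplex of the sandwich.  These vertices differ by multiples of unit
    vectors, so [l] is constant, and the constant is 0 because the [p_a] add up
    to 1. *)
Lemma partition_matrix_unit K p (z : 'I_n.+1 -> 'cV[R]_n) :
  affine_partition K p -> (forall a, K (z a)) ->
  \sum_a (1 - dot (p a) (hat (z a))) < 1 -> partition_matrix p \in unitmx.
Proof.
move=> [pK p1] Kz; set D := \sum_a _ => D1.
pose P i j := dot (p i) (hat (z j)).
have P0 i j : 0 <= P i j by exact: pK.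
have P1 j : \sum_i P i j = 1 by rewrite -dot_suml p1 dot_hat_hat dot0l addr0.
pose s i := \sum_(j | j != i) P i j.
have sD : \sum_i s i = D.
  rewrite /s (exchange_big_dep xpredT) //=; apply: eq_bigr => j _.
  by rewrite -[in RHS](P1 j) [in RHS](bigD1 j) //= addrAC subrr add0r;
     apply: eq_bigl => i; rewrite eq_sym.
rewrite unitmxE unitfE; apply/negP => /det0P [l l0 lP].
have lp : \sum_a l 0 a *: p a = 0 by rewrite -mul_partition_matrix lP trmx0.
have lz (j : 'I_n.+1) : \sum_i l 0 i * P i j = 0.
  transitivity (dot (\sum_a l 0 a *: p a) (hat (z j))); last by rewrite lp dot0l.
  by rewrite dot_suml; apply: eq_bigr => a _; rewrite dotZl.
(* t k is the k-th vertex of the inner simplex *)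
pose t k i := s i + (1 - D) * (i == k)%:R.
have tl k : \sum_i l 0 i * t k i = \sum_i l 0 i * s i + (1 - D) * l 0 k.
  under eq_bigr do rewrite /t mulrDr.
  rewrite big_split /= [X in _ + X](bigD1 k) //= eqxx mulr1.
  rewrite [X in _ + (_ + X)]big1 => [|i ik].
    by rewrite addr0 [l 0 k * _]mulrC.
  by rewrite (negPf ik) !mulr0.
have t1 k : \sum_i t k i = 1.
  rewrite big_split /= sD (bigD1 k) //= eqxx mulr1 big1 ?addr0 => [|i ik]; first by ring.
  by rewrite (negPf ik) mulr0.
have st k i : s i <= t k i by rewrite lerDl mulr_ge0 ?ler0n // subr_ge0 ltW.
have l_const k : \sum_i l 0 i * s i + (1 - D) * l 0 k = 0.
  rewrite -tl; apply/eqP; rewrite eq_le; apply/andP; split.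
    rewrite -oppr_ge0 -sumrN; under eq_bigr do rewrite -mulNr.
    apply: (stochastic_hull ord0 P0 P1 (st k) (t1 k)) => j.
    by under eq_bigr do rewrite mulNr; rewrite sumrN lz oppr0.
  by apply: (stochastic_hull ord0 P0 P1 (st k) (t1 k)) => j; rewrite lz.
have lE k : l 0 k = l 0 0.
  have /addrI : \sum_i l 0 i * s i + (1 - D) * l 0 k =
      \sum_i l 0 i * s i + (1 - D) * l 0 0 by rewrite !l_const.
  by apply: mulfI; rewrite subr_eq0 gt_eqF.
move/eqP: l0; apply; apply/matrixP => i k; rewrite ord1 mxE lE.
move: lp; under eq_bigr do rewrite lE.
rewrite -scaler_sumr p1 => /matrixP /(_ 0 0); rewrite mxE hat00 mulr1 => ->.
by rewrite mxE.
Qed.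

Lemma truncated_simplex_sub K p (z : 'I_n.+1 -> 'cV[R]_n) x :
  compact K -> convexly_closed K ->
  affine_partition K p -> (forall a, K (z a)) -> partition_matrix p \in unitmx ->
  (forall i, \sum_(j | j != i) dot (p i) (hat (z j)) <= dot (p i) (hat x)) ->
  K x.
Proof.
move=> cK cvK [pK p1] Kz PU px; apply: contrapT => nKx.
have K0 : K !=set0 by exists (z 0).
have [v [c [vx vK]]] := separation (compact_mx_closed cK) K0 cvK nKx.
pose q : 'cV[R]_(1 + n) := col_mx (- c)%:M v.
have qE y : dot q (hat y) = dot v y - c.
  rewrite dot_hat col_mxKd addrC; congr (_ + _).
  by rewrite mxE; case: splitP => [j _|//]; rewrite ord1 mxE eqxx.
pose l := q^T *m invmx (partition_matrix p).
have ql : q = \sum_a l 0 a *: p a.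
  by rewrite -mul_partition_matrix mulmxKV // trmxK.
have qlE y : dot q (hat y) = \sum_a l 0 a * dot (p a) (hat y).
  by rewrite {1}ql dot_suml; apply: eq_bigr => a _; rewrite dotZl.
have psum y : \sum_a dot (p a) (hat y) = 1.
  by rewrite -dot_suml p1 dot_hat_hat dot0l addr0.
have := @stochastic_hull R 'I_n.+1 (fun i j => dot (p i) (hat (z j)))
  (fun a => l 0 a) (fun a => dot (p a) (hat x)) ord0.
move=> /(_ (fun i j => pK i _ (Kz j)) (fun j => psum _) px (psum x)).
rewrite -qlE qE => H; have : 0 <= dot v x - c.
  by apply: H => j; rewrite -qlE qE subr_ge0 vK.
by rewrite subr_ge0 leNgt vx.
Qed.

Lemma bary_matrix_row (F : 'M[R]_(1 + n)) : bary_matrix F ->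
  const_mx 1 *m F = (hat 0)^T :> 'rV[R]_(1 + n).
Proof.
move=> [_ F1].
have H x : ((const_mx 1 *m F : 'rV[R]_(1 + n)) *m hat x) 0 0 = 1.
  by rewrite -mulmxA mxE -[RHS](F1 x); apply: eq_bigr => i _; rewrite mxE mul1r.
set r : 'rV[R]_(1 + n) := const_mx 1 *m F in H *.
have {}H x : dot r^T (hat x) = 1 by rewrite dotE trmxK.
apply: trmx_inj; rewrite trmxK.
have r0 : r^T 0 0 = 1 by rewrite -(H 0) dot_hat0.
have rd : dsubmx r^T = 0.
  apply: dot_eq0; have := H (dsubmx r^T); rewrite dot_hat r0.
  by rewrite -[RHS]addr0 => /addrI.
rewrite -[r^T]vsubmxK rd /hat; congr col_mx; apply/matrixP => i j.
rewrite !ord1 [RHS]mxE eqxx -[RHS]r0 mxE; congr (r^T _ _); exact/val_inj.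
Qed.

(** Both simplices of the sandwich are described by the barycentric coordinates
    [p]: the outer one by [p_i >= 0], the inner one by [p_i >= s_i], where [s_i]
    is the sum of the values of [p_i] at the points [z_j] with [j != i].  The
    [s_i] add up to [D], so the inner simplex is homothetic to the outer one
    with ratio [1 - D]. *)
Theorem bm_ratio_sandwich K S p (z : 'I_n.+1 -> 'cV[R]_n) :
  compact K -> convexly_closed K -> is_simplex S ->
  affine_partition K p -> (forall a, K (z a)) ->
  let D := \sum_a (1 - dot (p a) (hat (z a))) in
  D < 1 -> bm_ratio K S (1 - D)^-1.
Proof.
move=> cK cvK sS pP Kz D D1; have [pK p1] := pP.
have PU := partition_matrix_unit pP Kz D1.
have [F [[FU F1] SE]] := simplex_bary sS.
set P := partition_matrix p in PU.
have rowP : (hat 0)^T *m invmx P = const_mx 1 :> 'rV[R]_(1 + n).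
  have -> : (hat 0)^T = const_mx 1 *m P :> 'rV[R]_(1 + n).
    apply: trmx_inj; rewrite trmxK mul_partition_matrix -p1.
    by apply: eq_bigr => a _; rewrite mxE scale1r.
  by rewrite mulmxK.
pose G := invmx P *m F.
have GU : G \in unitmx by rewrite unitmx_mul unitmx_inv PU.
have rowG : (hat 0)^T *m G = (hat 0)^T.
  by rewrite mulmxA rowP bary_matrix_row.
pose b := dlsubmx G; pose A := drsubmx G.
have GE : G = block_mx 1%:M 0 b A.
  rewrite -[LHS]submxK -/b -/A; move: rowG; rewrite -{1}[G]submxK /hat tr_col_mx.
  rewrite mul_row_block trmx0 !mul0mx !addr0 trmx1 !mul1mx => /eq_row_mx [-> ->].
  by [].
have AU : A \in unitmx.
  by move: GU; rewrite GE !unitmxE det_lblock det1 mul1r.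
have PG x : P *m hat (A *m x + b) = F *m hat x.
  by rewrite -affine_hat -GE mulmxA mulKVmx.
have D01 : 0 < 1 - D by rewrite subr_gt0.
have P0 i j : 0 <= dot (p i) (hat (z j)) by exact: pK.
have psum y : \sum_a dot (p a) (hat y) = 1.
  by rewrite -dot_suml p1 dot_hat_hat dot0l addr0.
pose s : 'cV[R]_(1 + n) := \col_i \sum_(j | j != i) dot (p i) (hat (z j)).
have sD : \sum_i s i 0 = D.
  under eq_bigr do rewrite mxE.
  rewrite (exchange_big_dep xpredT) //=; apply: eq_bigr => j _.
  by rewrite -[in RHS](psum (z j)) [in RHS](bigD1 j) //= addrAC subrr add0r;
     apply: eq_bigl => i; rewrite eq_sym.
pose h := invmx P *m s.
have h0 : h 0 0 = D.
  rewrite -dot_hat0 dotC dotE /h mulmxA rowP mxE -[RHS]sD.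
  by apply: eq_bigr => i _; rewrite mxE mul1r.
split; first by rewrite invr_ge0 ltW.
exists A, (- b), (- ((1 - D)^-1 *: dsubmx h) - b); split=> //.
  move=> _ [x Kx <-]; pose y := invmx A *m (x - b).
  have Ay : A *m y + b = x by rewrite mulKVmx // subrK.
  exists y; last by rewrite -Ay addrC addrK.
  by rewrite SE => i /=; rewrite -PG Ay partition_matrixE; exact: pK.
move=> _ [y Sy <-]; pose x := A *m y + b.
have px i : 0 <= dot (p i) (hat x).
  by rewrite -partition_matrixE PG; move: Sy; rewrite SE; exact.
pose k := (1 - D) *: x + dsubmx h.
have hatk : hat k = (1 - D) *: hat x + h.
  have hu : usubmx h = D%:M.
    by rewrite [LHS]mx11_scalar mxE; congr (_%:M); rewrite -h0;
       congr (h _ _); exact/val_inj.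
  rewrite -[h in RHS]vsubmxK /hat scale_col_mx add_col_mx hu; congr col_mx.
  by rewrite scale_scalar_mx -raddfD /= mulr1 subrK.
exists k.
  apply: (truncated_simplex_sub cK cvK pP Kz PU) => i.
  rewrite hatk dotDr dotZr -[dot (p i) h]partition_matrixE mulKVmx // mxE.
  by rewrite lerDr mulr_ge0 // ltW.
rewrite /k scalerDr scalerA mulVf ?gt_eqF // scale1r /x.
move: (A *m y) (_ *: dsubmx h) => u w.
by apply/matrixP => i j; rewrite !mxE; ring.
Qed.

End Sandwich.

(** * The stability estimate *)

Section Stability.
Context {R : realType} {n : nat}.
Implicit Types (K S : set 'cV[R]_n).

Lemma enorm_le_sqrt (x : 'cV[R]_n) (b : R) : 0 <= b ->
  (enorm x <= Num.sqrt b) = (dot x x <= b).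
Proof. by move=> b0; rewrite /enorm ler_sqrt. Qed.

Lemma affine_preimage_compact K (L : 'M[R]_n) (c : 'cV[R]_n) :
  L \in unitmx -> compact K -> compact [set w | K (L *m w + c)].
Proof.
move=> LU cK; pose f (x : 'cV[R]_n) := invmx L *m (x - c).
have -> : [set w | K (L *m w + c)] = f @` K.
  apply/seteqP; split=> [w Kw|_ [x Kx <-] /=].
    by exists (L *m w + c); rewrite // /f addrK mulKmx.
  by rewrite /f mulKVmx // subrK.
apply: continuous_compact => //; apply: continuous_subspaceT.
apply: continuous_mx => i j.
have -> : (fun x => f x i j) = (fun x => \sum_k invmx L i k * (- c k j + x k j)).
  by apply/funext => x; rewrite mxE; apply: eq_bigr => k _; rewrite !mxE addrC.
apply: continuous_sum => k; apply: continuous_scale; apply: continuous_shift.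
exact: coord_continuous.
Qed.

Lemma affine_preimage_convex K (L : 'M[R]_n) (c : 'cV[R]_n) :
  convexly_closed K -> convexly_closed [set w | K (L *m w + c)].
Proof.
move=> cK x y t t01 /= Kx Ky.
have -> : L *m (t *: x + (1 - t) *: y) + c =
    t *: (L *m x + c) + (1 - t) *: (L *m y + c).
  rewrite mulmxDr -!scalemxAr.
  move: (L *m x) (L *m y) => u w; apply/matrixP => i j; rewrite !mxE; ring.
exact: cK.
Qed.

(** The slopes of a partition can only be made to approach
    [(n - eps) / sqrt n]; its square exceeds [n - 2 eps] by [eps^2 / n], which
    leaves room for the approximation. *)
Theorem simplex_stability K S (eps : R) :
  (0 < n)%N -> convex_body K -> is_simplex S -> 0 < eps < 1 / 2 ->
  n%:R - eps <= banach_mazur K (euclidean_ball R n) ->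
  banach_mazur K S <= (1 - eps) / (1 - 2 * eps).
Proof.
move=> n0 [cK /convex_setP cvK iK] sS eps01 Kn.
have [eps0 eps1] := andP eps01.
have n1 : 1 <= n%:R :> R by rewrite ler1n.
have [L [c [LU LK]]] := loewner n0 cK iK.
set K' := [set w | _] in LK.
have cK' : compact K' := affine_preimage_compact LU cK.
have cvK' : convexly_closed K' := affine_preimage_convex cvK.
have K'0 : K' !=set0.
  have [x /interior_subset Kx] := iK; exists (invmx L *m (x - c)).
  by rewrite /K' /= mulKVmx // subrK.
have s0 : 0 < Num.sqrt n%:R :> R by rewrite sqrtr_gt0 ltr0n.
pose X := (n%:R - eps) / Num.sqrt n%:R; pose Y := Num.sqrt (n%:R - 2 * eps).
have X0 : 0 < X by rewrite divr_gt0 //; lra.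
have YX : 0 <= Y < X.
  rewrite sqrtr_ge0 /= -(ltr_pXn2r (_ : 0 < 2)%N) ?nnegrE ?sqrtr_ge0 ?(ltW X0) //.
  rewrite sqr_sqrtr ?expr_div_n ?sqr_sqrtr ?ler0n //; last by lra.
  rewrite ltr_pdivlMr ?ltr0n //.
  by have := mulr_gt0 eps0 eps0; nra.
have noball y r : (forall x, enorm (x - y) <= r -> K' x) -> r <= X^-1.
  move=> yK; have [r0|r0] := lerP r 0.
    by rewrite (le_trans r0) // invr_ge0 ltW.
  have K'n x : K' x -> enorm x <= Num.sqrt n%:R.
    by move=> K'x; rewrite enorm_le_sqrt ?ler0n //; case: LK => _; apply.
  have := bm_ratio_affine LU (bm_ratio_ball r0 s0 yK K'n).
  move=> /banach_mazur_le /(le_trans Kn); rewrite /X invf_div ler_pdivlMr //.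
  by rewrite ler_pdivlMr ?(mulrC r) //; lra.
have [m [p [pP pY]]] := steep_partition n0 cK' K'0 cvK' YX noball.
have [m' [p' [p'P p'Y p'0 m'n]]] := small_partition cK' K'0 LK pP pY.
have slope : n%:R - 2 * eps <= (\sum_a enorm (dsubmx (p' a))) ^+ 2.
  have n2 : 0 <= n%:R - 2 * eps by lra.
  rewrite -(sqr_sqrtr n2) ler_pXn2r ?nnegrE ?sqrtr_ge0 //.
  by apply: sumr_ge0 => a _; exact: enorm_ge0.
have [m'E [z [Kz zD]]] := loewner_partition K'0 cK' LK p'0 p'P.1 p'P.2 m'n eps01 slope.
subst m'; set D := \sum_a _ in zD.
have D1 : D < 1 by apply: le_lt_trans zD _; rewrite ltr_pdivrMr; lra.
have := bm_ratio_affine LU (bm_ratio_sandwich cK' cvK' sS p'P Kz D1).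
move=> /banach_mazur_le /le_trans; apply.
rewrite -/D -[leRHS]invf_div lef_pV2 ?posrE ?subr_gt0 ?divr_gt0 //; try lra.
have : (1 - 2 * eps) / (1 - eps) = 1 - eps / (1 - eps) by field; lra.
by lra.
Qed.

Lemma stability_rate (eps : R) : 0 < eps < 1 / 2 ->
  (1 - eps) / (1 - 2 * eps) < 1 + 2 * eps + 2 * eps ^+ 2 / (1 - 2 * eps).
Proof.
move=> /andP[e0 e1]; rewrite -subr_gt0.
have -> : 1 + 2 * eps + 2 * eps ^+ 2 / (1 - 2 * eps) - (1 - eps) / (1 - 2 * eps)
    = eps by field; lra.
by [].
Qed.

Lemma stability_series (eps : R) : 0 < eps < 1 / 2 ->
  1 + 2 * eps + \sum_(2 <= k < N) 2 ^+ (k - 1) * eps ^+ k @[N --> \oo] -->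
  1 + 2 * eps + 2 * eps ^+ 2 / (1 - 2 * eps).
Proof.
move=> /andP[e0 e1]; apply: cvgD; first exact: cvg_cst.
rewrite -(cvg_shiftn 2) /=.
have -> : (fun N => \sum_(2 <= k < N + 2) 2 ^+ (k - 1) * eps ^+ k) =
    series (geometric (2 * eps ^+ 2) (2 * eps)).
  apply/funext => N; rewrite /series /= -[X in \sum_(X <= _ < _) _]add0n big_addn addnK.
  apply: eq_bigr => k _; rewrite /geometric /= exprMn addn2 subn1 /= !exprS.
  by ring.
by apply: cvg_geometric_series; rewrite ger0_norm; lra.
Qed.

End Stability.

(** * A truncated simplex is far from every simplex *)

(** Combinatorial form of the statement that a simplex with one vertex cut off
    is far from every simplex.  The rows of [k] are the barycentric coordinates
    of the vertices of an inner simplex, and every point [x] of the truncated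
    simplex is, up to the homothety with ratio [1 - eta], a mean of them.  Each
    of the uncut vertices needs a row of its own, and only one row is left for
    the two points near the cut. *)
Lemma truncated_simplex_far (R : realFieldType) (I : finType) (t b1 b2 : I)
    (k : I -> I -> R) (L : I -> R) (eps eta : R) :
  b1 != t -> b2 != t -> b1 != b2 -> 0 < eps < 1 / 2 ->
  (forall i b, 0 <= k i b) -> (forall i, \sum_b k i b = 1) ->
  (forall i, k i t <= 1 - eps) ->
  (forall b, 0 <= L b) -> \sum_b L b = eta ->
  (forall x : I -> R, (forall b, 0 <= x b) -> \sum_b x b = 1 -> x t <= 1 - eps ->
     exists q : I -> R, [/\ forall i, 0 <= q i, \sum_i q i = 1 &
       forall b, \sum_i q i * k i b = (1 - eta) * x b + L b]) ->
  eps <= 20 * eta.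
Proof.
move=> b1t b2t b12 /andP[e0 e1] k0 k1 kt L0 L1 H.
rewrite leNgt; apply/negP => small.
have Leta b : L b <= eta by rewrite -L1 (bigD1 b) //= lerDl sumr_ge0.
have eta0 : 0 <= eta by rewrite -L1 sumr_ge0.
have two (f : I -> R) a b : a != b -> (forall c, 0 <= f c) -> f a + f b <= \sum_c f c.
  move=> ab f0; rewrite (bigD1 a) //= (bigD1 b) 1?eq_sym //= addrA lerDl.
  exact: sumr_ge0.
have le1 (f : I -> R) a : (forall c, 0 <= f c) -> f a <= \sum_c f c.
  by move=> f0; rewrite (bigD1 a) //= lerDl sumr_ge0.
(* each uncut vertex b has a row i_b whose b-th entry is at least 1 - eta *)
have /choice [g gP] : forall b, exists i, b != t -> 1 - eta <= k i b.
  move=> b; have [->|bt] := eqVneq b t; first by exists t.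
  have [||| q [q0 q1 qk]] := H (fun c => (c == b)%:R).
  - by move=> c; rewrite ler0n.
  - by rewrite (bigD1 b) //= eqxx big1 ?addr0 // => c /negPf ->.
  - by rewrite eq_sym (negPf bt) mulr0n; lra.
  apply: contrapT => nex.
  have lt i : 0 < 1 - eta - k i b.
    by rewrite subr_gt0 ltNge; apply/negP => h; apply: nex; exists i.
  have : \sum_i q i * (1 - eta - k i b) = 0.
    apply/eqP; rewrite eq_le; apply/andP; split; last first.
      by apply: sumr_ge0 => i _; rewrite mulr_ge0 // ltW.
    under eq_bigr do rewrite mulrBr.
    by rewrite sumrB -mulr_suml q1 mul1r qk eqxx mulr1; have := L0 b; lra.
  move/eqP; rewrite psumr_eq0 => [/allP qz|i _]; last by rewrite mulr_ge0 // ltW.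
  have : \sum_i q i = 0.
    apply: big1 => i _; have := qz i (mem_index_enum _).
    by rewrite mulf_eq0 (gt_eqF (lt i)) orbF => /eqP.
  by rewrite q1 => /eqP; rewrite oner_eq0.
have gt' b : b != t -> k (g b) t <= eta.
  move=> bt; have := two (k (g b)) b t bt (k0 _); rewrite k1.
  by have := gP b bt; lra.
pose J := (g @: [set~ t])%SET.
have gI : {in [set~ t]%SET &, injective g}.
  move=> b b'; rewrite !inE => bt b't gb; apply/eqP/negPn/negP => bb.
  have := two (k (g b)) b b' bb (k0 _); rewrite k1.
  by have := gP b bt; have := gP b' b't; rewrite -gb; lra.
have /cards1P [j Jj] : #|~: J| == 1%N.
  rewrite cardsCs finset.setCK /J card_in_imset // cardsC1.
  have : (0 < #|I|)%N by apply/card_gt0P; exists t.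
  by case: #|I| => // m _; rewrite subSnn.
have outJ i : i != j -> exists2 b, b != t & i = g b.
  move=> ij; have : i \in J.
    apply/negPn/negP => iJ; have : i \in (~: J)%SET by rewrite finset.in_setC.
    by rewrite Jj finset.in_set1 (negPf ij).
  by move=> /imsetP [b]; rewrite !inE => bt ->; exists b.
pose l b i := 2 - eps - 2 * k i t - k i b.
have l0 b i : b != t -> 0 <= l b i.
  by move=> bt; have := two (k i) b t bt (k0 i); have := kt i; rewrite k1 /l; lra.
have key b : b != t -> 3 * l b j <= 8 * eta.
  move=> bt.
  have [||| q [q0 q1 qk]] :=
      H (fun c => (1 - eps) * (c == t)%:R + eps * (c == b)%:R).
  - by move=> c; rewrite addr_ge0 // mulr_ge0 ?ler0n //; lra.
  - rewrite big_split /= -!mulr_sumr.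
    have one c : \sum_(d : I) (d == c)%:R = 1 :> R.
      by rewrite (bigD1 c) //= eqxx big1 ?addr0 // => d /negPf ->.
    by rewrite !one; ring.
  - by rewrite eqxx [t == b]eq_sym (negPf bt) mulr0n mulr1n; lra.
  have qkt := qk t; have qkb := qk b.
  have lq : \sum_i q i * l b i <= 2 * eta.
    have E i : q i * l b i = (2 - eps) * q i - 2 * (q i * k i t) - q i * k i b.
      by rewrite /l; ring.
    under eq_bigr do rewrite E.
    rewrite !sumrB -!mulr_sumr q1 qkt qkb !eqxx (negPf bt) [t == b]eq_sym.
    rewrite (negPf bt) mulr0n mulr1n.
    by have := L0 t; have := L0 b; have := mulr_ge0 (ltW e0) eta0; lra.
  have qj : q j * l b j + (1 - q j) * (1 / 2 - 2 * eta) <= 2 * eta.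
    apply: le_trans lq; rewrite (bigD1 j) //= lerD2l.
    have -> : 1 - q j = \sum_(i | i != j) q i.
      by rewrite -q1 (bigD1 j) //= addrAC subrr add0r.
    rewrite mulr_suml; apply: ler_sum => i ij; rewrite ler_wpM2l //.
    have [b' b't ->] := outJ i ij; have := gt' b' b't.
    have := le1 (k (g b')) b (k0 _); rewrite k1 /l; lra.
  have lj := l0 b j bt.
  have qj0 : 3 / 4 <= q j.
    rewrite leNgt; apply/negP => qj34.
    have := mulr_ge0 (q0 j) lj.
    have : 1 / 4 * (1 / 2 - 2 * eta) <= (1 - q j) * (1 / 2 - 2 * eta).
      by rewrite ler_wpM2r //; lra.
    by lra.
  have qj1 : q j <= 1 by rewrite -q1 le1.
  have : 3 / 4 * l b j <= q j * l b j by rewrite ler_wpM2r.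
  have : 0 <= (1 - q j) * (1 / 2 - 2 * eta) by rewrite mulr_ge0 //; lra.
  by lra.
have := key b1 b1t; have := key b2 b2t; rewrite /l.
have : k j b1 + k j b2 + k j t <= 1.
  rewrite -(k1 j) (bigD1 t) //= (bigD1 b1) //= (bigD1 b2) /=; last first.
    by rewrite b2t eq_sym.
  have : 0 <= \sum_(i | (i != t) && (i != b1) && (i != b2)) k j i.
    by apply: sumr_ge0.
  by lra.
by have := kt j; lra.
Qed.

Section FiniteRatio.
Context {R : realType} {n : nat}.
Implicit Types (K L S : set 'cV[R]_n).

Definition round_body K : Prop :=
  (exists y r, 0 < r /\ forall x, enorm (x - y) <= r -> K x) /\
  (exists2 s, 0 < s & forall x, K x -> enorm x <= s).

(** Without a ratio the infimum defining [banach_mazur] would be that of the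
    empty set, hence 0, and lower bounds would fail. *)
Lemma bm_ratio_exists K L : round_body K -> round_body L ->
  exists rho, bm_ratio K L rho.
Proof.
move=> [[y [r0 [r00 yK]]] [s0 s00 Ks]] [[z [r1 [r10 zL]]] [s1 s10 Ls]].
pose a := s0 / r1; have a0 : 0 < a by rewrite divr_gt0.
pose rho := a * s1 / r0; have rho0 : 0 < rho by rewrite !mulr_gt0 ?invr_gt0.
exists rho; split; first exact: ltW.
exists a%:M, (a *: z), (- (rho *: y)); split.
- by rewrite unitmxE det_scalar unitrX // unitfE gt_eqF.
- move=> _ [x Kx <-]; exists (z + a^-1 *: x).
    apply: zL; rewrite addrAC subrr add0r enormZ ?invr_ge0 ?(ltW a0) //.
    by rewrite ler_pdivrMl // /a divfK ?gt_eqF // Ks.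
  by rewrite mul_scalar_mx scalerDr scalerA divff ?gt_eqF // scale1r.
move=> _ [x Lx <-]; exists (y + (a / rho) *: x).
  have ar : 0 <= a / rho by rewrite divr_ge0 // ltW.
  apply: yK; rewrite addrAC subrr add0r enormZ //.
  apply: le_trans (ler_wpM2l ar (Ls _ Lx)) _.
  by rewrite /rho le_eqVlt; apply/orP; left; apply/eqP; field; rewrite !gt_eqF.
rewrite mul_scalar_mx scalerDr scalerA addKr.
by congr (_ *: _); field; rewrite gt_eqF.
Qed.

Lemma enorm_le_entries (x : 'cV[R]_n) (b : R) : 0 <= b ->
  (forall i, `|x i 0| <= b) -> enorm x <= Num.sqrt (n%:R * b ^+ 2).
Proof.
move=> b0 xb; apply: ler_wsqrtr; rewrite mulr_natl -[n in leRHS]card_ord -sumr_const.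
apply: ler_sum => i _; rewrite -expr2 -real_normK ?num_real //.
by rewrite ler_pXn2r ?nnegrE.
Qed.

Lemma bounded_enorm K (b : R) : 0 <= b ->
  (forall x, K x -> forall i, `|x i 0| <= b) ->
  exists2 s, 0 < s & forall x, K x -> enorm x <= s.
Proof.
move=> b0 Kb; exists (Num.sqrt (n%:R * b ^+ 2) + 1).
  by rewrite ltr_wpDl ?sqrtr_ge0.
by move=> x Kx; apply: le_trans (enorm_le_entries b0 (Kb x Kx)) _; rewrite lerDl.
Qed.

Lemma convex_body_round K : convex_body K -> round_body K.
Proof.
move=> [/compact_mx_bounded [b b0 Kb] _ [y /interior_box [r r0 yK]]]; split.
  exists y, r; split=> // x xy; apply: yK => i j; rewrite ord1.
  by have := enorm_coord (x - y) i; rewrite !mxE => /le_trans; apply.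
by apply: (@bounded_enorm K b (ltW b0)) => x Kx i; exact: Kb.
Qed.

Lemma euclidean_ball_round : round_body (euclidean_ball R n).
Proof.
split; last by exists 1 => // x; rewrite euclidean_ballE.
by exists 0, 1; split=> // x; rewrite subr0 euclidean_ballE.
Qed.

Lemma mulmx_bounded (m k : nat) (F : 'M[R]_(m, k)) : exists2 C : R, 0 < C &
  forall (x : 'cV[R]_k) (b : R), 0 <= b -> (forall j, `|x j 0| <= b) ->
    forall i, `|(F *m x) i 0| <= C * b.
Proof.
exists (1 + \sum_i \sum_j `|F i j|) => [|x b b0 xb i].
  by rewrite ltr_pwDl // sumr_ge0 // => i _; apply: sumr_ge0.
rewrite mxE (le_trans (ler_norm_sum _ _ _)) //.
apply: le_trans (_ : \sum_j `|F i j| * b <= _).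
  by apply: ler_sum => j _; rewrite normrM ler_wpM2l.
rewrite -mulr_suml ler_wpM2r // (bigD1 i) //= addrCA lerDl.
by rewrite addr_ge0 // sumr_ge0 // => j _; apply: sumr_ge0.
Qed.

Lemma bary_point (F : 'M[R]_(1 + n)) (l : 'cV[R]_(1 + n)) :
  bary_matrix F -> \sum_i l i 0 = 1 ->
  hat (dsubmx (invmx F *m l)) = invmx F *m l.
Proof.
move=> bF l1; have [FU _] := bF; set w := invmx F *m l.
have w0 : w 0 0 = 1.
  rewrite -dot_hat0 dotC dotE /w mulmxA -(bary_matrix_row bF) mulmxK // mxE.
  by rewrite -[RHS]l1; apply: eq_bigr => i _; rewrite mxE mul1r.
rewrite -[RHS]vsubmxK /hat; congr col_mx.
apply/matrixP => i j; rewrite !ord1 [LHS]mxE eqxx mulr1n -[LHS]w0 [RHS]mxE.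
by congr (w _ _); exact/val_inj.
Qed.

Lemma simplex_round S : is_simplex S -> round_body S.
Proof.
move=> /simplex_bary [F [[FU F1] ->]].
have n0 : 0 < (n.+1)%:R :> R by rewrite ltr0n.
split; last first.
  have [C C0 CF] := mulmx_bounded (invmx F).
  apply: (@bounded_enorm _ (C * 1)); first by rewrite mulr1 ltW.
  move=> x /= Fx i.
  have -> : x i 0 = (invmx F *m (F *m hat x)) (rshift 1 i) 0.
    by rewrite mulKmx // col_mxEd.
  apply: CF => // j; rewrite ger0_norm //.
  by rewrite -(F1 x) (bigD1 j) //= lerDl sumr_ge0.
pose w : 'cV[R]_(1 + n) := invmx F *m const_mx (n.+1)%:R^-1.
pose y := dsubmx w.
have haty : hat y = w.
  apply: bary_point => //; under eq_bigr do rewrite mxE.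
  by rewrite sumr_const card_ord -[LHS]mulr_natr mulVf // gt_eqF.
have [C C0 CF] := mulmx_bounded F.
exists y, ((n.+1)%:R^-1 / C); split; first by rewrite divr_gt0 // invr_gt0.
move=> x xy i /=.
have -> : hat x = hat y + (col_mx 0 (x - y) : 'cV[R]_(1 + n)).
  by rewrite /hat add_col_mx addr0 [y + _]addrC subrK.
rewrite mulmxDr haty /w mulKVmx // mxE [X in X + _]mxE.
have := CF (col_mx 0 (x - y)) ((n.+1)%:R^-1 / C) _ _ i.
rewrite mulrCA divff ?gt_eqF // mulr1 => H.
suff : `|(F *m col_mx 0 (x - y)) i 0| <= (n.+1)%:R^-1.
  by rewrite ler_norml => /andP[h _]; rewrite -lerBlDl sub0r.
apply: H => [|j]; first by rewrite divr_ge0 // ?invr_ge0 ltW.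
rewrite mxE; case: splitP => k _.
  by rewrite mxE normr0 divr_ge0 // ?invr_ge0 ltW.
by rewrite (le_trans (enorm_coord _ _)).
Qed.

(** An ellipsoid around [K] centred at the origin contains with [z_a] also the
    opposite point, and this point lies in a translate of [rho K]; there [p_a]
    is bounded below.  Adding up these bounds eliminates the translations,
    because the gradients of the [p_a] add up to 0. *)
Lemma bm_ball_lower_bound K (m : nat) (p : 'I_m -> 'cV[R]_(1 + n))
    (z : 'I_m -> 'cV[R]_n) rho :
  affine_partition K p -> (forall a, K (z a)) ->
  bm_ratio K (euclidean_ball R n) rho ->
  \sum_a dot (p a) (hat (z a)) - 1 <= rho.
Proof.
move=> [pK p1] Kz [rho0 [A [u [v [AU KA AK]]]]].
have key a : dot (p a) (hat (z a)) <=
    (1 + rho) * p a 0 0 - dot (dsubmx (p a)) (u + v).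
  have [|e e1 ez] := KA (u + z a); first by exists (z a).
  have [|x Kx xe] := AK (A *m - e).
    exists (- e) => //; rewrite euclidean_ballE /enorm dotNl dotNr opprK.
    by rewrite -/(enorm e) -euclidean_ballE.
  have := mulr_ge0 rho0 (pK a x Kx); rewrite dot_hat mulrDr -dotZr.
  have -> : rho *: x = - (u + z a) - v.
    by rewrite -ez -mulmxN -xe addrAC subrr add0r.
  rewrite dot_hat dotBr dotNr !dotDr; lra.
have : \sum_a dot (p a) (hat (z a)) <=
    \sum_a ((1 + rho) * p a 0 0 - dot (dsubmx (p a)) (u + v)).
  by apply: ler_sum => a _; exact: key.
rewrite sumrB -mulr_sumr.
have -> : \sum_a p a 0 0 = 1.
  by rewrite -summxE p1 hat00.
have -> : \sum_a dot (dsubmx (p a)) (u + v) = 0.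
  by rewrite -dot_suml -raddf_sum p1 /= col_mxKd dot0l.
by lra.
Qed.

End FiniteRatio.

Section TruncatedCorner.
Context {R : realType} {n : nat}.

(** Barycentric coordinates of the simplex spanned by 0 and the unit vectors;
    the coordinate of the vertex 0 comes first. *)
Definition corner_coord (b : 'I_(1 + n)) : 'cV[R]_(1 + n) :=
  match fintype.split b with
  | inl _ => col_mx 1%:M (const_mx (-1))
  | inr i => col_mx 0 (delta_mx i 0)
  end.

Lemma corner_coord_l x : dot (corner_coord (lshift n 0)) (hat x) = 1 - \sum_i x i 0.
Proof.
rewrite /corner_coord; case: splitP => [k _|k //].
rewrite dot_hat col_mxKd mxE; case: splitP => [j _|//]; rewrite ord1 mxE eqxx.
congr (_ + _); rewrite -sumrN; apply: eq_bigr => i _.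
by rewrite mxE mulN1r.
Qed.

Lemma corner_coord_r x i : dot (corner_coord (rshift 1 i)) (hat x) = x i 0.
Proof.
rewrite /corner_coord; case: splitP => [k /=|k /= [/val_inj <-]].
  by have := ltn_ord k; case: (val k).
rewrite dot_hat col_mxKd mxE; case: splitP => [j _|//]; rewrite mxE add0r.
rewrite /dot (bigD1 i) //= mxE !eqxx mul1r big1 ?addr0 // => l li.
by rewrite mxE (negPf li) mul0r.
Qed.

Lemma corner_coord_sum : \sum_b corner_coord b = hat 0.
Proof.
have H x : dot (\sum_b corner_coord b) (hat x) = 1.
  rewrite dot_suml big_split_ord big_ord1 /= corner_coord_l.
  by under eq_bigr do rewrite corner_coord_r; rewrite subrK.
set q := \sum_b _ in H *.
have q0 : q 0 0 = 1 by rewrite -dot_hat0 H.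
have qd : dsubmx q = 0.
  apply: dot_eq0; have := H (dsubmx q); rewrite dot_hat q0.
  by rewrite -[RHS]addr0 => /addrI.
rewrite -[q]vsubmxK qd /hat; congr col_mx; apply/matrixP => i j.
by rewrite !ord1 [RHS]mxE eqxx -[RHS]q0 mxE; congr (q _ _); exact/val_inj.
Qed.

Definition truncated_corner (t : 'I_(1 + n)) (eps : R) : set 'cV[R]_n :=
  [set x | (forall b, 0 <= dot (corner_coord b) (hat x)) /\
           dot (corner_coord t) (hat x) <= 1 - eps].

Lemma truncated_corner_point t eps (c : 'I_(1 + n) -> R) :
  (forall b, 0 <= c b) -> \sum_b c b = 1 -> c t <= 1 - eps ->
  exists2 x, truncated_corner t eps x &
    forall b, dot (corner_coord b) (hat x) = c b.
Proof.
move=> c0 c1 ct; pose x : 'cV[R]_n := \col_i c (rshift 1 i).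
have xE b : dot (corner_coord b) (hat x) = c b.
  have bE := splitK b; rewrite -{}bE; case: (fintype.split b) => k /=.
    rewrite ord1 corner_coord_l -c1 big_split_ord big_ord1 /=.
    by under [X in _ - X]eq_bigr do rewrite mxE; rewrite addrK.
  by rewrite corner_coord_r mxE.
by exists x => //; split=> [b|]; rewrite xE.
Qed.

Lemma truncated_corner_partition t eps :
  affine_partition (truncated_corner t eps) corner_coord.
Proof. by split=> [b x [+ _]|]; [exact|exact: corner_coord_sum]. Qed.

Lemma truncated_corner_body i0 eps : (2 <= n)%N -> 0 < eps < 1 / 2 ->
  convex_body (truncated_corner (rshift 1 i0) eps).
Proof.
set t := rshift 1 i0; move=> n2 /andP[e0 e1]; split.
- apply: (@mx_heine_borel _ _ _ _ 1).
    have -> : truncated_corner t eps =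
        \bigcap_b [set x | 0 <= dot (corner_coord b) (hat x)] `&`
        [set x | 0 <= (1 - eps) + dot (- corner_coord t) (hat x)].
      apply/seteqP; split=> x [xp xt]; split.
      + by move=> b _; exact: xp.
      + by move: xt => /=; rewrite dotNl; lra.
      + by move=> b; exact: xp.
      + by move: xt => /=; rewrite dotNl; lra.
    apply: closedI.
      by apply: closed_bigI => b _; apply: closed_ge0; exact: continuous_dot_hat.
    by apply: closed_ge0; apply: continuous_shift; exact: continuous_dot_hat.
  move=> x [xp _] i j; rewrite ord1.
  have xi k : 0 <= x k 0 by rewrite -corner_coord_r.
  have := xp (lshift n 0); rewrite corner_coord_l (bigD1 i) //= ger0_norm //.
  have : 0 <= \sum_(k | k != i) x k 0 by apply: sumr_ge0.
  by lra.
- apply/convex_setP => x y a /andP[a0 a1] [xp xt] [yp yt].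
  have aff b : dot (corner_coord b) (hat (a *: x + (1 - a) *: y)) =
      a * dot (corner_coord b) (hat x) + (1 - a) * dot (corner_coord b) (hat y).
    by rewrite !dot_hat dotDr !dotZr; ring.
  split=> [b|]; rewrite aff.
    by rewrite addr_ge0 // mulr_ge0 // subr_ge0.
  have := ler_wpM2l a0 xt; have := ler_wpM2l (_ : 0 <= 1 - a) yt.
  by rewrite subr_ge0 => /(_ a1); lra.
have n0 : 2 <= n%:R :> R by rewrite (ler_nat R 2).
pose h : R := (n%:R + 1)^-1; have h0 : 0 < h by rewrite invr_gt0; lra.
have nh : n%:R * h = 1 - h by rewrite /h; field; lra.
pose e := h / n%:R; have e'0 : 0 < e by rewrite divr_gt0 //; lra.
have ne : n%:R * e = h by rewrite /e mulrCA divff ?mulr1 //; lra.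
have h3 : h <= 1 / 3 by nra.
have e6 : e <= 1 / 6 by nra.
have eh : e <= h by nra.
exists (const_mx h); apply/nbhs_ballP; exists e => //= x [_ xh].
have {}xh i : h - e <= x i 0 <= h + e.
  have := xh i 0; rewrite /ball /= mxE ltr_norml => /andP[? ?].
  by apply/andP; split; lra.
split=> [b|]; last by rewrite corner_coord_r; have /andP[] := xh i0; lra.
have bE := splitK b; rewrite -{}bE; case: (fintype.split b) => k /=.
  rewrite ord1 corner_coord_l.
  have : \sum_i x i 0 <= \sum_(i < n) (h + e).
    by apply: ler_sum => i _; have /andP[] := xh i.
  by rewrite sumr_const card_ord -[leRHS]mulr_natl mulrDr ne nh; lra.
by rewrite corner_coord_r; have /andP[] := xh k; lra.
Qed.

End TruncatedCorner.

Section LowerExample.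
Context {R : realType} {n : nat}.

Lemma hat_sum (m : nat) (q : 'I_m -> R) (x : 'I_m -> 'cV[R]_n) :
  \sum_i q i = 1 -> hat (\sum_i q i *: x i) = \sum_i q i *: hat (x i).
Proof.
move=> q1; have -> : \sum_i q i *: hat (x i) =
    col_mx (\sum_i q i *: 1%:M) (\sum_i q i *: x i).
  elim/big_rec3: _ => [|i a b c _ ->]; first by rewrite col_mx0.
  by rewrite /hat scale_col_mx add_col_mx.
by rewrite -scaler_suml q1 scale1r.
Qed.

(** In a sandwich between [S] and [rho] times [K], the vertices of [S]
    correspond to points [k_i] of [K], and every point of [K] is, up to a
    homothety, the mean of the [k_i] with weights its barycentric coordinates in
    [S]. *)
Lemma truncated_corner_far (i0 i1 : 'I_n) (eps rho : R) (S : set 'cV[R]_n) :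
  i1 != i0 -> 0 < eps < 1 / 2 -> is_simplex S ->
  bm_ratio (truncated_corner (rshift 1 i0) eps) S rho -> 1 + eps / 20 <= rho.
Proof.
set t := rshift 1 i0; set K := truncated_corner t eps.
move=> i10 eps01 sS [rho0 [A [u [v [AU KA AK]]]]].
have [eps0 eps1] := andP eps01.
pose b1 : 'I_(1 + n) := lshift n 0; pose b2 : 'I_(1 + n) := rshift 1 i1.
have b1t : b1 != t by [].
have b12 : b1 != b2 by [].
have b2t : b2 != t by apply: contraNneq i10 => /rshift_inj ->.
have [F [[FU F1] SE]] := simplex_bary sS.
pose s i : 'cV[R]_n := dsubmx (invmx F *m delta_mx i 0).
have hats i : hat (s i) = invmx F *m delta_mx i 0.
  apply: bary_point => //; rewrite (bigD1 i) //= mxE !eqxx big1 ?addr0 //.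
  by move=> j /negPf ji; rewrite mxE ji.
have Ss i : S (s i).
  by rewrite SE => j /=; rewrite hats mulKVmx // mxE ler0n.
have /choice [k kP] : forall i, exists x, K x /\ v + rho *: x = A *m s i.
  by move=> i; have [|x Kx xE] := AK (A *m s i); [exists (s i)|exists x].
have Kq x : K x -> exists q : 'I_(1 + n) -> R,
    [/\ forall i, 0 <= q i, \sum_i q i = 1 &
        u + x = v + rho *: \sum_i q i *: k i].
  move=> Kx; have [|y Sy yE] := KA (u + x); first by exists x.
  exists (fun i => (F *m hat y) i 0); split=> //; first by move: Sy; rewrite SE.
  have ys : y = \sum_i (F *m hat y) i 0 *: s i.
    transitivity (dsubmx (hat y)); first by rewrite col_mxKd.
    rewrite -{1}[hat y](mulKmx FU) [X in invmx F *m X]matrix_sum_delta.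
    rewrite mulmx_sumr raddf_sum; apply: eq_bigr => i _ /=.
    by rewrite big_ord1 -scalemxAr linearZ.
  rewrite -yE {1}ys mulmx_sumr.
  transitivity (\sum_i ((F *m hat y) i 0 *: v + rho *: ((F *m hat y) i 0 *: k i))).
    apply: eq_bigr => i _; rewrite -scalemxAr -(kP i).2 scalerDr !scalerA.
    by rewrite [rho * _]mulrC.
  by rewrite big_split /= -scaler_suml F1 scale1r -scaler_sumr.
pose p := @corner_coord R n.
pose e (b c : 'I_(1 + n)) : R := (c == b)%:R.
have e_sum b : \sum_c e b c = 1.
  by rewrite (bigD1 b) //= /e eqxx big1 ?addr0 // => c /negPf ->.
have vertex b : b != t -> exists2 x, K x & forall c, dot (p c) (hat x) = e b c.
  move=> bt; apply: truncated_corner_point.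
  - by move=> c; rewrite ler0n.
  - exact: e_sum.
  by rewrite /e eq_sym (negPf bt) mulr0n; lra.
have rho_gt0 : 0 < rho.
  rewrite lt_neqAle rho0 andbT eq_sym; apply/eqP => rhoE.
  have same x : K x -> x = v - u.
    by move=> /Kq [q [_ _]]; rewrite rhoE scale0r addr0 => <-; rewrite addrC addKr.
  have [x Kx xE] := vertex b1 b1t; have [y Ky yE] := vertex b2 b2t.
  have : dot (p b1) (hat x) = dot (p b1) (hat y) by rewrite (same x) // (same y).
  by rewrite xE yE /e eqxx (negPf b12) => /eqP; rewrite oner_eq0.
pose w := rho^-1 *: (u - v); pose eta := 1 - rho^-1.
pose L b := eta * p b 0 0 + dot (dsubmx (p b)) w.
have psum : \sum_b p b = hat 0 := corner_coord_sum.
have pq x : K x -> exists q : 'I_(1 + n) -> R,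
    [/\ forall i, 0 <= q i, \sum_i q i = 1 &
     forall b, \sum_i q i * dot (p b) (hat (k i)) = (1 - eta) * dot (p b) (hat x) + L b].
  move=> Kx; have [q [q0 q1 qE]] := Kq x Kx; exists q; split=> // b.
  have -> : \sum_i q i * dot (p b) (hat (k i)) = dot (p b) (hat (\sum_i q i *: k i)).
    rewrite hat_sum // [RHS]dotC dot_suml; apply: eq_bigr => i _.
    by rewrite dotZl dotC.
  have -> : \sum_i q i *: k i = rho^-1 *: x + w.
    apply: (scalerI (lt0r_neq0 rho_gt0)); rewrite scalerDr !scalerA divff ?gt_eqF //.
    by rewrite !scale1r addrA [x + u]addrC qE addrAC subrr add0r.
  by rewrite /L /eta !dot_hat dotDr dotZr; ring.
have L1 : \sum_b L b = eta.
  rewrite big_split /= -mulr_sumr -summxE psum hat00 mulr1.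
  by rewrite -dot_suml -raddf_sum psum /= col_mxKd dot0l addr0.
have kK i b : 0 <= dot (p b) (hat (k i)) by have [[+ _] _] := kP i; exact.
have L0 b : 0 <= L b.
  have [b' b't bb'] : exists2 b', b' != t & b != b'.
    by have [->|bb] := eqVneq b b1; [exists b2|exists b1].
  have [x Kx xE] := vertex b' b't; have [q [q0 _ qE]] := pq x Kx.
  have := qE b; rewrite xE /e (negPf bb') mulr0 add0r => <-.
  by apply: sumr_ge0 => i _; rewrite mulr_ge0.
have : eps <= 20 * eta.
  apply: (@truncated_simplex_far _ _ t b1 b2
    (fun i b => dot (p b) (hat (k i))) L) => //.
  - by move=> i; rewrite -dot_suml psum dot_hat_hat dot0l addr0.
  - by move=> i; have [[_ +] _] := kP i.
  move=> x x0 x1 xt; have [y Ky yE] := truncated_corner_point x0 x1 xt.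
  have [q [q0 q1 qE]] := pq y Ky; exists q; split=> // b.
  by rewrite qE yE.
rewrite /eta => H.
have r1 : rho * rho^-1 = 1 by rewrite divff // gt_eqF.
have : rho^-1 <= 1 - eps / 20 by lra.
move=> /(ler_wpM2l rho0); rewrite r1.
by nra.
Qed.

Lemma truncated_corner_ball (i0 : 'I_n) (eps rho : R) : 0 < eps < 1 / 2 ->
  bm_ratio (truncated_corner (rshift 1 i0) eps) (euclidean_ball R n) rho ->
  n%:R - eps <= rho.
Proof.
set t := rshift 1 i0; move=> /andP[eps0 eps1] H.
pose p := @corner_coord R n.
have /choice [z zP] : forall b, exists x, truncated_corner t eps x /\
    dot (p b) (hat x) = 1 - eps * (b == t)%:R.
  move=> b; pose b1 : 'I_(1 + n) := lshift n 0.
  have b1t : t != b1 by [].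
  pose c a : R := (1 - eps * (b == t)%:R) * (a == b)%:R
                  + eps * (b == t)%:R * (a == b1)%:R.
  have s01 : 0 <= eps * (b == t)%:R <= eps by case: (b == t); rewrite ?mulr1n ?mulr0n; lra.
  have e_sum (d : 'I_(1 + n)) : \sum_a (a == d)%:R = 1 :> R.
    by rewrite (bigD1 d) //= eqxx big1 ?addr0 // => a /negPf ->.
  have [a|||x Kx xE] := @truncated_corner_point R n t eps c.
  - have [s0 s1] := andP s01.
    by rewrite addr_ge0 // mulr_ge0 ?ler0n //; lra.
  - by rewrite big_split /= -!mulr_sumr !e_sum; ring.
  - rewrite /c (negPf b1t) mulr0 addr0; by have [_|_] := eqVneq b t; rewrite ?mulr1n ?mulr0n; lra.
  exists x; split=> //; rewrite xE /c eqxx mulr1; have [->|bt] := eqVneq b t.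
    by rewrite (negPf b1t) mulr0 addr0.
  by rewrite mulr0n mulr0 mul0r addr0.
have := bm_ball_lower_bound (truncated_corner_partition t eps)
  (fun b => (zP b).1) H.
apply: le_trans; under eq_bigr do rewrite (zP _).2.
rewrite sumrB -mulr_sumr sumr_const card_ord (bigD1 t) //= eqxx.
rewrite big1 => [|b /negPf -> //].
by rewrite [1 *+ (1 + n)]mulrS addr0 mulr1; lra.
Qed.

End LowerExample.

Theorem theorem1p2 (R : realType) :
  (* the estimate, and the series expansion of its right-hand side *)
  (forall (n : nat) (K S : set 'cV[R]_n) (eps : R),
    (0 < n)%N -> convex_body K -> is_simplex S -> 0 < eps < 1 / 2 ->
    n%:R - eps <= banach_mazur K (euclidean_ball R n) ->
    banach_mazur K S < 1 + 2 * eps + 2 * eps ^+ 2 / (1 - 2 * eps) /\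
    1 + 2 * eps + \sum_(2 <= k < N) 2 ^+ (k - 1) * eps ^+ k @[N --> \oo] -->
      1 + 2 * eps + 2 * eps ^+ 2 / (1 - 2 * eps)) /\
  (* for eps <= gamma the estimate is linear in eps, and this order is optimal
     (for n = 1 every convex body is a simplex) *)
  (forall gamma : R, 0 < gamma < 1 / 2 ->
    exists c C : R, [/\ 0 < c,
      forall (n : nat) (K S : set 'cV[R]_n) (eps : R),
        (0 < n)%N -> convex_body K -> is_simplex S -> 0 < eps <= gamma ->
        n%:R - eps <= banach_mazur K (euclidean_ball R n) ->
        banach_mazur K S <= 1 + C * eps &
      forall (n : nat) (eps : R), (2 <= n)%N -> 0 < eps <= gamma ->
        exists K : set 'cV[R]_n,
          [/\ convex_body K,
              n%:R - eps <= banach_mazur K (euclidean_ball R n) &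
              forall S : set 'cV[R]_n, is_simplex S ->
                1 + c * eps <= banach_mazur K S]]).
Proof.
split=> [n K S eps n0 cK sS eps01 Kn|gamma /andP[g0 g1]].
  split; last exact: stability_series.
  exact: le_lt_trans (simplex_stability n0 cK sS eps01 Kn) (stability_rate eps01).
exists (1 / 20), (1 / (1 - 2 * gamma)); split=> //.
  move=> n K S eps n0 cK sS /andP[e0 eg] Kn.
  have eps01 : 0 < eps < 1 / 2 by apply/andP; split; lra.
  apply: le_trans (simplex_stability n0 cK sS eps01 Kn) _.
  have -> : (1 - eps) / (1 - 2 * eps) = 1 + 1 / (1 - 2 * eps) * eps by field; lra.
  rewrite lerD2l ler_wpM2r ?(ltW e0) // !mul1r lef_pV2 ?posrE; lra.
move=> n eps n2 /andP[e0 eg].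
have eps01 : 0 < eps < 1 / 2 by apply/andP; split; lra.
pose i0 : 'I_n := Ordinal (ltnW n2); pose i1 : 'I_n := Ordinal n2.
have bodyK := truncated_corner_body i0 n2 eps01.
exists (truncated_corner (rshift 1 i0) eps); split=> // [|S sS].
  apply: le_banach_mazur => [|rho]; last exact: truncated_corner_ball.
  by apply: bm_ratio_exists; [exact: convex_body_round|exact: euclidean_ball_round].
apply: le_banach_mazur => [|rho H].
  by apply: bm_ratio_exists; [exact: convex_body_round|exact: simplex_round].
have i10 : i1 != i0 by [].
by have := truncated_corner_far i10 eps01 sS H; lra.
Qed.
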